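(* Suppose that for every irreducible polynomial $P \in \mathbb{Z}[x]$ of degree $d$ one has $\Psi_P(x,y) \sim \rho(du)\,x$ where $x=y^u$. Let $\alpha$ be an algebraic number of degree $d \ge 2$ such that the ring of algebraic integers of the number field $\mathbb{Q}(\alpha)$ is a unique factorization domain. Then $$\dim_{\mathbb{Q}} \operatorname{Span}_{\mathbb{Q}}\{\log(n+\alpha) : n \in \mathbb{Z},\ 0 \le n < x\} \sim (1-\rho(d))\,x \qquad (x \to \infty).$$
   Context: For a polynomial $P \in \mathbb{Z}[x]$ and real $x,y \ge 2$, $\Psi_P(x,y)$ denotes the number of integers in the set $\{P(n) : 1 \le n < x\}$ all of whose prime factors are less than or equal to $y$. The Dickman function $\rho:[0,\infty)\to\mathbb{R}$ is defined by $\rho(u)=1$ for $0 \le u \le 1$ and $\rho'(u) = -\rho(u-1)/u$ for $u>1$. $\log$ denotes the principal branch of the complex logarithm, and $\operatorname{Span}_{\mathbb{Q}}$ is the $\mathbb{Q}$-linear span inside $\mathbb{C}$. *)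

(* Defs.v *)
From HB Require Import structures.
From mathcomp Require Import all_boot all_order all_algebra finmap.
From mathcomp Require Import all_classical all_reals all_analysis.
From mathcomp Require Import complex.

Set Implicit Arguments.
Unset Strict Implicit.
Unset Printing Implicit Defensive.

Import Order.TTheory GRing.Theory Num.Theory.
Import numFieldNormedType.Exports.

Local Open Scope classical_set_scope.
Local Open Scope ring_scope.

Canonical pinfty_filter_on (R : numFieldType) : filter_on R :=
  FilterType (pinfty_nbhs R) (@proper_pinfty_nbhs R).

Definition asymp_equiv (R : realType) (f g : R -> R) : Prop :=
  f ~_(pinfty_nbhs R) g.

(** Divisibility theory relative to a subring [A], given as a set, of an ambient
    commutative ring. *)
Section Factorization.
Variables (T : comNzRingType) (A : set T).

Definition unit_in (u : T) : Prop := A u /\ exists v, A v /\ u * v = 1.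

Definition associated_in (a b : T) : Prop := exists u, unit_in u /\ b = u * a.

Definition irreducible_in (p : T) : Prop :=
  [/\ A p, p <> 0, ~ unit_in p &
      forall a b, A a -> A b -> p = a * b -> unit_in a \/ unit_in b].

Definition irreducible_seq (s : seq T) : Prop :=
  forall p, p \in s -> irreducible_in p.

Definition is_ufd : Prop :=
  (forall a, A a -> a <> 0 -> ~ unit_in a ->
     exists s, irreducible_seq s /\ a = \prod_(p <- s) p) /\
  (forall s t, irreducible_seq s -> irreducible_seq t ->
     \prod_(p <- s) p = \prod_(q <- t) q ->
     exists t', [/\ perm_eq t t', size s = size t' &
       forall i, (i < size s)%N -> associated_in s`_i t'`_i]).

End Factorization.

(** [0] is not smooth, being divisible by every prime. *)
Definition smooth (R : realType) (y : R) (z : int) : Prop :=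
  forall p : nat, prime p -> (p %| `|z|)%N -> p%:R <= y.

Definition Psi (R : realType) (P : {poly int}) (x y : R) : nat :=
  #|` fset_set [set z : int |
        (exists n : nat, [/\ (1 <= n)%N, n%:R < x & z = P.[n%:Z]])
        /\ smooth y z] |.

(** Continuity is what ties the value on [[0, 1]] to the differential equation
    on [u > 1]; the values of [rho] at negative arguments are irrelevant. *)
Definition is_dickman (R : realType) (rho : R -> R) : Prop :=
  [/\ {within `[0, +oo[, continuous rho},
      (forall u : R, 0 <= u <= 1 -> rho u = 1) &
      (forall u : R, 1 < u -> is_derive u 1 rho (- rho (u - 1) / u))].

Section ComplexNumbers.
Variable R : realType.
Local Notation C := R[i].

Definition carg (z : C) : R :=
  let t := acos (complex.Re z / ComplexField.Normc.normc z) in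
  if 0 <= complex.Im z then t else - t.

Definition clog (z : C) : C :=
  Complex (ln (ComplexField.Normc.normc z)) (carg z).

Lemma normc_gt0 (z : C) : z != 0 -> 0 < ComplexField.Normc.normc z.
Proof.
move=> z0; rewrite lt_neqAle; apply/andP; split; last first.
  by case: z {z0} => x y /=; exact: sqrtr_ge0.
by rewrite eq_sym; apply: contraNN z0 => /eqP/ComplexField.Normc.eq0_normc ->.
Qed.

Lemma normc_sqr (x y : R) :
  ComplexField.Normc.normc (Complex x y) ^+ 2 = x ^+ 2 + y ^+ 2.
Proof. by rewrite /= sqr_sqrtr// addr_ge0// sqr_ge0. Qed.

Lemma carg_cos_sqr (x y : R) (r := ComplexField.Normc.normc (Complex x y)) :
  0 < r -> 1 - (x / r) ^+ 2 = (y / r) ^+ 2.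
Proof.
move=> r0; have r2 : r ^+ 2 != 0 by rewrite expf_neq0// gt_eqF.
apply: (mulIf r2).
rewrite mulrBl mul1r -!exprMn !mulfVK ?gt_eqF// /r normc_sqr.
by rewrite addrC addKr.
Qed.

Lemma carg_cos_itv (x y : R) (r := ComplexField.Normc.normc (Complex x y)) :
  0 < r -> -1 <= x / r <= 1.
Proof.
move=> r0; rewrite -ler_norml -[leRHS]normr1 -ler_sqr ?nnegrE//.
by rewrite !real_normK ?num_real// expr1n -subr_ge0 carg_cos_sqr// sqr_ge0.
Qed.

Lemma carg_itv (z : C) : z != 0 -> - pi < carg z <= pi.
Proof.
move=> /normc_gt0; case: z => x y r0; rewrite /carg.
have it := carg_cos_itv r0; case: ifPn => /=.
  by move=> _; rewrite acos_lepi// andbT (lt_le_trans _ (acos_ge0 it))// oppr_lt0 pi_gt0.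
rewrite -ltNge => y0; apply/andP; split; last first.
  by rewrite (le_trans _ (pi_ge0 R))// oppr_le0 acos_ge0.
rewrite ltrN2 acos_ltpi//; case/andP: it => lo hi; rewrite hi andbT lt_neqAle lo andbT.
apply/negP => /eqP e; have := carg_cos_sqr r0.
rewrite /= -e sqrrN expr1n subrr => /esym/eqP.
by rewrite sqrf_eq0 mulf_eq0 invr_eq0 lt_eqF//= gt_eqF.
Qed.

Lemma carg_polar (z : C) : z != 0 ->
  z = Complex (ComplexField.Normc.normc z * cos (carg z))
              (ComplexField.Normc.normc z * sin (carg z)).
Proof.
move=> /normc_gt0; case: z => x y r0.
have it := carg_cos_itv r0; have e := carg_cos_sqr r0.
move: r0 it e; rewrite /carg [complex.Re _]/= [complex.Im _]/=.
set r := ComplexField.Normc.normc _ => r0 it e.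
have rE (t : R) : r * (t / r) = t by rewrite mulrC mulfVK// gt_eqF.
have ct : cos (acos (x / r)) = x / r by rewrite acosK// in_itv.
have st : sin (acos (x / r)) = `|y| / r.
  by rewrite sin_acos// e sqrtr_sqr normrM normfV (gtr0_norm r0).
case: ifPn => y0; first by rewrite ct st (ger0_norm y0) !rE.
rewrite -ltNge in y0.
by rewrite cosN sinN ct st (ltr0_norm y0) mulNr opprK !rE.
Qed.

Definition alg_degree (a : C) (d : nat) : Prop :=
  exists p : {poly rat},
    [/\ p \is monic, size p = d.+1, root (map_poly ratr p) a &
        forall q : {poly rat}, root (map_poly ratr q) a -> p %| q].

Definition Qadjoin (a : C) : set C :=
  [set z | exists p q : {poly rat},
     (map_poly ratr q).[a] != 0 /\
     z = (map_poly ratr p).[a] / (map_poly ratr q).[a]].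

Definition integers_of (K : set C) : set C :=
  [set z | K z /\ integralOver (intr : int -> C) z].

Definition Qspan (S : set C) : set C :=
  [set z | exists (n : nat) (s : 'I_n -> C) (c : 'I_n -> rat),
     (forall i, S (s i)) /\ z = \sum_(i < n) ratr (c i) * s i].

Definition Qfree (n : nat) (b : 'I_n -> C) : Prop :=
  forall c : 'I_n -> rat, \sum_(i < n) ratr (c i) * b i = 0 -> forall i, c i = 0.

Definition Qbasis (V : set C) (n : nat) (b : 'I_n -> C) : Prop :=
  Qfree b /\ Qspan (range b) = V.

(** The length of a finite [Q]-basis of [V], and [0] if there is none. *)
Definition Qdim (V : set C) : nat :=
  xget 0%N [set n | exists b : 'I_n -> C, Qbasis V b].

Definition log_shifts (a : C) (x : R) : set C :=
  [set z | exists n : int, [/\ 0 <= n, n%:~R < x & z = clog (n%:~R + a)]].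

End ComplexNumbers.

(* Main.v *)
Require Import Defs.
From HB Require Import structures.
From mathcomp Require Import all_boot all_order all_algebra finmap.
From mathcomp Require Import all_classical all_reals all_analysis.
From mathcomp Require Import complex zify lra ring.

(** Put [g = - a] and let [P] be the primitive integer polynomial of degree [d]
    with root [g], so that [P(n)] is, up to a constant, the norm of [n - g = n + a].

    Lower bound: the [log (n + a)] for which [P(n)] has a prime factor [p > x] are
    independent.  A relation gives, after exponentiation and Gauss's lemma, an
    identity [prod_A (n - X)^a_n - prod_B (n - X)^b_n = P Q] in [Z[X]] with [A] and
    [B] disjoint; evaluating at [X = m] in [A] shows that [p] divides some nonzero
    [n - m] with [|n - m| < x].

    Upper bound: for the remaining [n], unique factorization writes each [n - g] as
    a unit times a product of irreducible factors of primes [<= x] (up to a constant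
    factor).  There are at most [d pi(x) = o(x)] of these.  Given more than
    [d pi(x) + 2 d + 1] such [n], Dirichlet's pigeonhole argument yields a nonzero
    integer vector [k] with [sum_n k_n = 0], with all exponents of
    [u = prod_n (n - g)^k_n] zero, so that [u] is a unit, and with the logarithms of
    all the conjugates of [u] close to [0].  Then the norm of [u - 1] is an integer
    of absolute value less than [1], so [u = 1] and [sum_n k_n log (n + a) = 0].

    Hence the dimension is the number of [n < x] with [P(n)] not [x]-smooth, up to
    [o(x)], and the hypothesis on [Psi] counts these. *)

Set Implicit Arguments.
Unset Strict Implicit.
Unset Printing Implicit Defensive.

Import Order.TTheory GRing.Theory Num.Theory.
Import numFieldNormedType.Exports.

Local Open Scope nat_scope.

(** * Primes up to [n] *)

Lemma prod_primes_dvdn (s : seq nat) (N : nat) :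
  uniq s -> all prime s -> all (dvdn^~ N) s -> \prod_(p <- s) p %| N.
Proof.
elim: s => [|p s IH] /=; first by rewrite big_nil dvd1n.
move=> /andP[ps us] /andP[pp sp] /andP[pN sN].
rewrite big_cons Gauss_dvd ?pN ?IH//.
have co : all (fun q => coprime q p) s.
  apply/allP => q qs; rewrite prime_coprime ?(allP sp q qs)//.
  by rewrite dvdn_prime2 ?(allP sp q qs)//; apply: contraNneq ps => <-.
rewrite coprime_sym.
elim: s co {IH ps us sp sN} => [|q s IH] /=; first by rewrite big_nil coprime1n.
by move=> /andP[qp /IH sp]; rewrite big_cons coprimeMl qp.
Qed.

(** The two middle entries of row [2 m + 1] are equal, and the whole row sums to [2 * 4 ^ m]. *)
Lemma bin_mid_le m : 'C(m.*2.+1, m) <= 4 ^ m.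
Proof.
have e : 'C(m.*2.+1, m.+1) = 'C(m.*2.+1, m).
  by rewrite -[RHS]bin_sub; [congr 'C(_, _); lia | lia].
have := expnDn 1 1 m.*2.+1; rewrite addn1.
have lm : m < m.*2.+2 by lia.
have lm1 : m.+1 < m.*2.+2 by lia.
rewrite (bigD1 (Ordinal lm))//= (bigD1 (Ordinal lm1))/=; last first.
  by rewrite -val_eqE/=; lia.
rewrite !exp1n !muln1 e.
set Z := (X in _ + (_ + X)) => h.
have : 2 ^ m.*2.+1 = 2 * 4 ^ m by rewrite expnS -mul2n expnM.
lia.
Qed.

(** Erdos's induction: an even [n > 2] is not prime, and for [n = 2 m + 1] the primes in
    [(m + 1, n]] divide a central binomial coefficient, which is at most [4 ^ m]. *)
Lemma primorial_le n : \prod_(0 <= p < n.+1 | prime p) p <= 4 ^ n.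
Proof.
have [k] := ubnP n; elim: k n => // k IH n nk.
have [n2|n2] := leqP n 2.
  by case: n n2 {nk} => [|[|[|]]]// _; rewrite !big_mkcond/= !big_nat_recr ?big_geq//=.
have [on|en] := boolP (odd n); last first.
  rewrite big_mkcond big_nat_recr/=; last by lia.
  have -> : prime n = false.
    by apply/negP => pn; have := even_prime pn; rewrite (negbTE en); lia.
  rewrite muln1 -big_mkcond/=; case: n n2 nk {en} => // n n2 nk.
  by apply: leq_trans (IH _ _) _; [lia|rewrite leq_exp2l].
have [m nE] : exists m, n = m.*2.+1 by exists n./2; lia.
have m0 : 0 < m by lia.
rewrite (@big_cat_nat _ _ _ m.+2) /=; [|lia|lia].
have -> : 4 ^ n = 4 ^ m.+1 * 4 ^ m by rewrite -expnD; congr (_ ^ _); lia.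
apply: leq_mul; first by apply: IH; lia.
apply: leq_trans (bin_mid_le m).
apply: dvdn_leq; first by rewrite bin_gt0; lia.
rewrite -big_filter; apply: prod_primes_dvdn.
- by rewrite filter_uniq// iota_uniq.
- by apply/allP => p; rewrite mem_filter => /andP[].
apply/allP => p; rewrite mem_filter mem_index_iota => /and3P[pp lp pn].
have : p %| 'C(m.*2.+1, m) * (m`! * (m.*2.+1 - m)`!).
  by rewrite bin_fact; [rewrite dvdn_fact//; lia|lia].
rewrite !Euclid_dvdM//.
have nf q : q < p -> (p %| q`!) = false.
  elim: q => [|q IHq] qp; first by rewrite fact0 dvdn1; case: eqP pp => // ->.
  rewrite factS Euclid_dvdM// IHq; last by lia.
  by rewrite orbF gtnNdvd.
by rewrite !nf ?orbF//; lia.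
Qed.

Definition prime_count n := \sum_(0 <= p < n.+1 | prime p) 1.

(* The primes between [4 ^ L] and [n] contribute at least [4 ^ L] each to the
   primorial, which is at most [4 ^ n]. *)
Lemma prime_count_le L n : L * prime_count n <= n + L * 4 ^ L.
Proof.
suff H : 4 ^ (L * (prime_count n - 4 ^ L)) <= 4 ^ n.
  move: H; rewrite leq_exp2l//; nia.
apply: leq_trans (primorial_le n).
have [le|lt] := leqP n.+1 (4 ^ L).
  have : prime_count n <= n.+1.
    by rewrite /prime_count sum1_count (leq_trans (count_size _ _))// size_iota.
  move=> h; have -> : prime_count n - 4 ^ L = 0 by lia.
  rewrite muln0 expn0; apply: prodn_cond_gt0 => p; exact: prime_gt0.
rewrite (@big_cat_nat _ _ _ (4 ^ L)) /=; [|lia|lia].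
have pos : 0 < \prod_(0 <= p < 4 ^ L | prime p) p.
  by apply: prodn_cond_gt0 => p; exact: prime_gt0.
apply: leq_trans (leq_pmull _ pos).
have : \prod_(4 ^ L <= p < n.+1 | prime p) 4 ^ L <= \prod_(4 ^ L <= p < n.+1 | prime p) p.
  rewrite big_nat_cond [leqRHS]big_nat_cond; apply: leq_prod => p /andP[/andP[]]//.
apply: leq_trans; rewrite big_const_seq iter_muln muln1 -expnM leq_exp2l// leq_mul2l.
apply/orP; right; rewrite /prime_count (@big_cat_nat _ _ _ (4 ^ L)) /=; [|lia|lia].
rewrite leq_subLR leq_add//; last by rewrite -sum1_count leqnn.
by rewrite sum1_count (leq_trans (count_size _ _))// size_iota subn0.
Qed.

Local Open Scope classical_set_scope.
Local Open Scope ring_scope.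

Local Notation "p ^ratr" := (map_poly ratr p) (at level 2, format "p ^ratr").

(** * Small values of integer linear forms, and the complex exponential *)

(** Pigeonhole: the integer vectors in a large box outnumber the cells of side [e] that their values
    can occupy; [k] is the difference of two vectors sharing a cell. *)
Lemma dirichlet_forms (R : realType) (I J : finType) (A : I -> J -> R) (e : R) :
  0 < e -> (#|J| < #|I|)%N ->
  exists k : I -> int, (exists i, k i != 0) /\
    forall j, `|\sum_i (k i)%:~R * A i j| < e.
Proof.
move=> e0 JI; pose C : R := \sum_i \sum_j `|A i j|.
have C0 : 0 <= C by apply: sumr_ge0 => i _; apply: sumr_ge0.
have [D hD] : exists D : nat, 2 * C / e + 1 <= D%:R.
  exists (Num.truncn (2 * C / e + 1)).+1; apply: ltW.
  suff /truncn_itv/andP[] : 0 <= 2 * C / e + 1 by [].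
  by rewrite addr_ge0// divr_ge0 ?mulr_ge0// ltW.
have D1 : (0 < D)%N.
  rewrite -(ltr_nat R); apply: lt_le_trans hD.
  by rewrite ltr_wpDl// divr_ge0 ?mulr_ge0// ltW.
(* With this [N], [(D * N + 1) ^ #|J| <= (D * (N + 1)) ^ #|J| = N * (N + 1) ^ #|J|], which is less
   than the number of vectors. *)
pose N := (D ^ #|J|)%N.
pose y (k : {ffun I -> 'I_N.+1}) j : R := \sum_i (k i)%:R * A i j.
have yb k j : `|y k j| <= N%:R * C.
  apply: le_trans (ler_norm_sum _ _ _) _; rewrite mulr_sumr; apply: ler_sum => i _.
  rewrite normrM normr_nat; apply: ler_pM => //; first by rewrite ler_nat -ltnS.
  by rewrite (bigD1 j)//= lerDl sumr_ge0.
(* The shift by the bound on [y k j] makes the cell coordinate nonnegative; the choice of [D] keeps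
   it at most [D * N]. *)
pose t k j := (y k j + N%:R * C) / e.
have t0 k j : 0 <= t k j.
  apply: divr_ge0; last exact: ltW.
  by have := yb k j; rewrite ler_norml => /andP[]; lra.
have tb k j : (Num.truncn (t k j) < (D * N).+1)%N.
  rewrite ltnS -(ler_nat R); have /andP[h _] := truncn_itv (t0 k j).
  apply: le_trans h _; rewrite /t ler_pdivrMr//.
  have := yb k j; rewrite ler_norml => /andP[_ h].
  have : N%:R * (2 * C) <= N%:R * (D%:R * e).
    rewrite ler_wpM2l// -ler_pdivrMr//; lra.
  rewrite natrM; lra.
pose box k : {ffun J -> 'I_(D * N).+1} := [ffun j => Ordinal (tb k j)].
have /injectivePn[k1 [k2 k12 bk]] : ~~ injectiveb box.
  apply/negP => /injectiveP/leq_card; rewrite !card_ffun !card_ord => h.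
  have : (((D * N).+1 ^ #|J|) < N.+1 ^ #|I|)%N.
    apply: (@leq_trans (N.+1 ^ #|J|.+1)); last first.
      by rewrite leq_exp2l// /N ltnS expn_gt0 D1.
    apply: (@leq_ltn_trans ((D * N.+1) ^ #|J|)).
      by case: #|J| => // n; rewrite leq_exp2r// mulnS; lia.
    by rewrite expnMn -/N expnS ltn_pmul2r// expn_gt0.
  by rewrite ltnNge h.
exists (fun i => (k1 i)%:Z - (k2 i)%:Z); split.
  have /existsP[i0 ki0] : [exists i, k1 i != k2 i].
    apply: contraNT k12 => /existsPn h; apply/eqP/ffunP => i; apply/eqP.
    by have := h i; rewrite negbK.
  by exists i0; rewrite subr_eq0.
move=> j.
have -> : \sum_i ((k1 i)%:Z - (k2 i)%:Z)%:~R * A i j = y k1 j - y k2 j.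
  by rewrite -sumrB; apply: eq_bigr => i _; rewrite rmorphB/= mulrBl.
have -> : y k1 j - y k2 j = e * (t k1 j - t k2 j).
  by rewrite /t; field; rewrite gt_eqF.
rewrite normrM gtr0_norm// -[ltRHS]mulr1 ltr_pM2l//.
have /ffunP/(_ j) := bk; rewrite !ffunE => /(congr1 val)/= tt.
have /andP[a1 a2] := truncn_itv (t0 k1 j).
have /andP[b1 b2] := truncn_itv (t0 k2 j).
rewrite tt in a1 a2; rewrite -natr1 in a2 b2.
by rewrite ltr_norml; apply/andP; split; lra.
Qed.

Section ComplexExponential.
Variable R : realType.
Local Notation C := R[i].

Definition cexp (z : C) : C :=
  Complex (expR (complex.Re z) * cos (complex.Im z))
          (expR (complex.Re z) * sin (complex.Im z)).

Lemma cexp0 : cexp 0 = 1.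
Proof. by rewrite /cexp/= expR0 cos0 sin0 mulr1 mulr0. Qed.

Lemma cexpD : {morph cexp : z w / z + w >-> z * w}.
Proof.
case=> a b [c d]; rewrite /cexp/= expRD cosD sinD.
by apply/eqP; rewrite eq_complex/=; apply/andP; split; apply/eqP; ring.
Qed.

Lemma cexp_clog z : z != 0 -> cexp (clog z) = z.
Proof.
move=> z0; rewrite /cexp/clog/= lnK ?posrE ?normc_gt0//.
by rewrite -carg_polar.
Qed.

Lemma cexp_neq0 z : cexp z != 0.
Proof.
apply/eqP => h; have := cexpD z (- z); rewrite subrr cexp0 h mul0r.
by move/eqP; rewrite oner_eq0.
Qed.

Lemma cexpN z : cexp (- z) = (cexp z)^-1.
Proof.
apply: (mulfI (cexp_neq0 z)); rewrite mulfV ?cexp_neq0//.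
by rewrite -cexpD subrr cexp0.
Qed.

Lemma cexp_sum (I : Type) (r : seq I) (P : pred I) (F : I -> C) :
  cexp (\sum_(i <- r | P i) F i) = \prod_(i <- r | P i) cexp (F i).
Proof. by apply: (big_morph cexp cexpD cexp0). Qed.

Lemma cexpMz (k : int) z : cexp (k%:~R * z) = cexp z ^ k.
Proof.
rewrite mulrzl; case: k => n.
  rewrite -pmulrn -exprnP; elim: n => [|n IH]; first by rewrite mulr0n cexp0.
  by rewrite mulrS cexpD IH exprS.
rewrite -[RHS]/(cexp z ^- n.+1) NegzE mulrNz cexpN -pmulrn; congr _^-1.
elim: n.+1 => [|m IH]; first by rewrite mulr0n cexp0.
by rewrite mulrS cexpD IH exprS.
Qed.

(** For [z = a + i b], the squared modulus of [cexp z - 1] is [1 + exp a * (exp a - 2 cos b)], so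
    [exp a < 3 / 2] and [cos b > 3 / 4] suffice. *)
Lemma cexp_near1 : exists2 e : R, 0 < e & forall z : C,
  `|complex.Re z| < e -> `|complex.Im z| < e ->
  ComplexField.Normc.normc (cexp z - 1) < 1.
Proof.
have : \forall t \near (0 : R), expR t < 3 / 2 /\ 3 / 4 < cos t.
  near=> t; split; near: t.
    apply: (@cvgr_lt _ _ _ _ (@expR R) (expR 0)); first exact: continuous_expR.
    by rewrite expR0; lra.
  apply: (@cvgr_gt _ _ _ _ (@cos R) (cos 0)); first exact: continuous_cos.
  by rewrite cos0; lra.
move/nbhs_ballP => [e /= e0 he]; exists e => // -[a b] /= ae be.
have [ha _] : expR a < 3 / 2 /\ 3 / 4 < cos a by apply: he; rewrite /ball/= sub0r normrN.
have [_ hb] : expR b < 3 / 2 /\ 3 / 4 < cos b by apply: he; rewrite /ball/= sub0r normrN.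
rewrite -[ltRHS]sqrtr1 ltr_sqrt//.
have := cos2Dsin2 b; have := expR_gt0 a; nra.
Unshelve. all: by end_near.
Qed.

(** Comparing moduli gives real part [0]; the bound on the imaginary part excludes the other
    multiples of [2 pi i]. *)
Lemma cexp_eq1 z : cexp z = 1 -> `|complex.Im z| < 1 -> z = 0.
Proof.
case: z => a b; rewrite /cexp => -[/= h1 h2] b1.
have e1 : expR a = 1.
  have : expR a ^+ 2 = 1.
    have : expR a ^+ 2 * (cos b ^+ 2 + sin b ^+ 2) = 1.
      by rewrite mulrDr -!exprMn h1 h2; ring.
    by rewrite cos2Dsin2 mulr1.
  by move/eqP; rewrite sqrf_eq1 => /orP[/eqP//|/eqP h]; have := expR_gt0 a; rewrite h; lra.
move: h1; rewrite e1 mul1r => c1.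
have -> : a = 0 by apply: expR_inj; rewrite e1 expR0.
have p1 : 1 < pi :> R by have := pi_ge2 R; lra.
have : `|b| = 0.
  apply: (@cos_inj R); rewrite ?in_itv/= ?normr_ge0 ?lexx ?pi_ge0//.
    by apply: ltW; apply: lt_trans p1.
  by rewrite cos0; have [_|_] := ger0P b; rewrite ?cosN.
by move/normr0_eq0 ->.
Qed.

End ComplexExponential.

(** * Dimensions of rational spans *)

Section RationalSpans.
Variable R : realType.
Local Notation C := R[i].

Lemma Qspan_sub (S : set C) : S `<=` Qspan S.
Proof.
move=> z Sz; exists 1%N, (fun=> z), (fun=> 1); split => //.
by rewrite big_ord1 rmorph1 mul1r.
Qed.

Lemma Qspan0 (S : set C) : Qspan S 0.
Proof. by exists 0%N, (fun=> 0), (fun=> 0); split; [case|rewrite big_ord0]. Qed.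

Lemma QspanD (S : set C) z w : Qspan S z -> Qspan S w -> Qspan S (z + w).
Proof.
move=> [n [s [c [Ss ->]]]] [m [t [e [St ->]]]].
exists (n + m)%N, (fun i => match fintype.split i with inl j => s j | inr j => t j end).
exists (fun i => match fintype.split i with inl j => c j | inr j => e j end); split.
  by move=> i; case: splitP => j _.
rewrite big_split_ord/=; congr (_ + _); apply: eq_bigr => i _.
  by rewrite (unsplitK (inl i)).
by rewrite (unsplitK (inr i)).
Qed.

Lemma QspanZ (S : set C) (q : rat) z : Qspan S z -> Qspan S (ratr q * z).
Proof.
move=> [n [s [c [Ss ->]]]]; exists n, s, (fun i => q * c i); split => //.
by rewrite mulr_sumr; apply: eq_bigr => i _; rewrite rmorphM mulrA.
Qed.

Lemma Qspan_sum (S : set C) (I : Type) (r : seq I) (P : pred I) (F : I -> C) :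
  (forall i, P i -> Qspan S (F i)) -> Qspan S (\sum_(i <- r | P i) F i).
Proof. by move=> h; apply: big_ind => //; [exact: Qspan0|exact: QspanD]. Qed.

Lemma Qspan_mono (S T : set C) : S `<=` Qspan T -> Qspan S `<=` Qspan T.
Proof.
move=> ST z [n [s [c [Ss ->]]]]; apply: Qspan_sum => i _.
by apply: QspanZ; apply: ST.
Qed.

Lemma Qspan_rangeP n (b : 'I_n -> C) z :
  Qspan (range b) z -> exists c : 'I_n -> rat, z = \sum_(i < n) ratr (c i) * b i.
Proof.
move=> [m [s [e [sb ->]]]].
have /choice[h hE] : forall i, exists j, s i = b j.
  by move=> i; have [j _ <-] := sb i; exists j.
exists (fun j => \sum_(i < m | h i == j) e i).
rewrite (partition_big h predT)//=; apply: eq_bigr => j _.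
by rewrite rmorph_sum mulr_suml; apply: eq_bigr => i /eqP <-; rewrite hE.
Qed.

(** If [m < n], the [n] by [m] matrix expressing [b] in terms of [e] has a nonzero vector in its
    left kernel, which is a relation among the [b i]. *)
Lemma Qfree_span_leq n m (b : 'I_n -> C) (e : 'I_m -> C) :
  Qfree b -> (forall i, Qspan (range e) (b i)) -> (n <= m)%N.
Proof.
move=> fb be; rewrite leqNgt; apply/negP => mn.
have /choice[A AE] : forall i, exists c : 'I_m -> rat,
    b i = \sum_(j < m) ratr (c j) * e j.
  by move=> i; apply: Qspan_rangeP.
pose M := \matrix_(i < n, j < m) A i j.
have : kermx M != 0.
  by rewrite kermx_eq0; apply/negP => /eqP h; have := rank_leq_col M; rewrite h; lia.
move=> /rowV0Pn[v /sub_kermxP vM v0].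
have : \sum_(i < n) ratr (v 0 i) * b i = 0.
  under eq_bigr do rewrite AE mulr_sumr.
  rewrite exchange_big big1//= => j _.
  under eq_bigr do rewrite mulrA -rmorphM.
  rewrite -mulr_suml -rmorph_sum.
  have -> : \sum_i v 0 i * A i j = (v *m M) 0 j.
    by rewrite mxE; apply: eq_bigr => i _; rewrite mxE.
  by rewrite vM mxE rmorph0 mul0r.
move/fb => v00; case/negP: v0; apply/eqP/rowP => i; rewrite mxE.
exact: v00.
Qed.

(** All finite bases have the same length, so the choice made by [xget] does not matter. *)
Lemma Qdim_basis (V : set C) n (b : 'I_n -> C) : Qbasis V b -> Qdim V = n.
Proof.
move=> [fb bV]; rewrite /Qdim.
case: xgetP => [m _ [e [fe eV]]|/(_ n)]; last by case; exists b.
apply/eqP; rewrite eqn_leq; apply/andP; split.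
  apply: (Qfree_span_leq (e := b) fe) => i; rewrite bV -eV.
  by apply: Qspan_sub; exists i.
apply: (Qfree_span_leq (e := e) fb) => i; rewrite eV -bV.
by apply: Qspan_sub; exists i.
Qed.

(** Independence is that of an indexed family: two indices in [J] with the same value of [l] are
    dependent. *)
Definition Qfree_on (N : nat) (l : 'I_N -> C) (J : {set 'I_N}) : Prop :=
  forall c : 'I_N -> rat, \sum_(i in J) ratr (c i) * l i = 0 ->
  forall i, i \in J -> c i = 0.

Lemma Qfree_onS N (l : 'I_N -> C) (J K : {set 'I_N}) :
  J \subset K -> Qfree_on l K -> Qfree_on l J.
Proof.
move=> JK fK c cJ i iJ.
pose c' i := if i \in J then c i else 0.
have := fK c' _ i (fintype.subsetP JK i iJ); rewrite /c' iJ; apply.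
rewrite -[RHS]cJ [LHS](big_setID J)/= (finset.setIidPr JK) [X in _ + X]big1 ?addr0.
  by apply: eq_bigr => j ->.
by move=> j /finset.setDP[_ /negbTE ->]; rewrite rmorph0 mul0r.
Qed.

Lemma Qfree_on_enum N (l : 'I_N -> C) (J : {set 'I_N}) :
  Qfree_on l J -> Qfree (fun i : 'I_#|J| => l (enum_val i)).
Proof.
move=> fJ c h i.
pose c' j := \sum_(k : 'I_#|J| | enum_val k == j) c k.
have c'E k : c' (enum_val k) = c k.
  by rewrite /c' (big_pred1 k)// => k'; rewrite (inj_eq enum_val_inj).
rewrite -c'E; apply: (fJ c'); last exact: enum_valP.
by rewrite -[RHS]h big_enum_val; apply: eq_bigr => k _; rewrite c'E.
Qed.

(** Take [J] maximal among the independent index sets: adding any other index creates a relation,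
    which expresses that vector through those of [J]. *)
Lemma Qbasis_subfamily N (l : 'I_N -> C) : exists J : {set 'I_N},
  Qfree_on l J /\ Qbasis (Qspan (range l)) (fun i : 'I_#|J| => l (enum_val i)).
Proof.
pose F (J : {set 'I_N}) := `[< Qfree_on l J >].
have F0 : F finset.set0 by apply/asboolP => c _ i; rewrite inE.
have [J /maxsetP[FJ maxJ] _] := maxset_exists F0.
have fJ : Qfree_on l J by apply/asboolP.
exists J; split => //; split; first exact: Qfree_on_enum.
apply/seteqP; split; apply: Qspan_mono.
  by move=> _ [i _ <-]; apply: Qspan_sub; exists (enum_val i).
move=> _ [i _ <-].
have inJ j : j \in J -> Qspan (range (fun i : 'I_#|J| => l (enum_val i))) (l j).
  move=> jJ; apply: Qspan_sub; exists (enum_rank_in jJ j) => //=.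
  by rewrite enum_rankK_in.
have [iJ|iJ] := boolP (i \in J); first exact: inJ.
have : ~ Qfree_on l (i |: J).
  move=> /asboolP h; have := maxJ _ h (finset.subsetUr _ _).
  by move=> e; move: iJ; rewrite -e setU11.
move=> /existsNP[c /not_implyP[cs /existsNP[k /not_implyP[kJ ck]]]].
rewrite big_setU1//= in cs.
(* Otherwise the relation would already live on [J], which is free. *)
have ci : c i != 0.
  apply/eqP => ci; rewrite ci rmorph0 mul0r add0r in cs.
  move: kJ; rewrite in_setU1 => /orP[/eqP ki|kJ]; first by rewrite ki ci in ck.
  by apply: ck; apply: fJ cs _ kJ.
have -> : l i = ratr (- (c i)^-1) * \sum_(j in J) ratr (c j) * l j.
  apply: (mulfI (_ : ratr (c i) != 0)); first by rewrite fmorph_eq0.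
  rewrite mulrA -rmorphM mulrN divff// rmorphN1 mulN1r.
  by apply/eqP; rewrite -addr_eq0 cs.
by apply: QspanZ; apply: Qspan_sum => j jJ; apply: QspanZ; apply: inJ.
Qed.

Lemma Qdim_ge_free N (l : 'I_N -> C) (J : {set 'I_N}) :
  Qfree_on l J -> (#|J| <= Qdim (Qspan (range l)))%N.
Proof.
move=> fJ; have [K [fK bK]] := Qbasis_subfamily l; rewrite (Qdim_basis bK).
apply: (Qfree_span_leq (e := fun i : 'I_#|K| => l (enum_val i)) (Qfree_on_enum fJ)) => i; rewrite bK.2.
by apply: Qspan_sub; exists (enum_val i).
Qed.

Lemma clear_denominators (I : finType) (c : I -> rat) : exists (D : nat) (k : I -> int),
  (0 < D)%N /\ forall i, c i * D%:R = (k i)%:~R.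
Proof.
exists (\prod_i `|denq (c i)|)%N, (fun i => numq (c i) * (\prod_(j | j != i) `|denq (c j)|)%N%:Z).
split; first by apply: prodn_gt0 => i; rewrite absz_gt0 denq_neq0.
move=> i; rewrite (bigD1 i)//= natrM mulrA rmorphM/=; congr (_ * _).
rewrite -{1}(divq_num_den (c i)) pmulrn gtz0_abs ?denq_gt0//.
by rewrite mulfVK// intr_eq0 denq_neq0.
Qed.

End RationalSpans.

(** * Norms and integrality in [Q(g)] *)

Lemma horner_char_poly (F : comNzRingType) n (M : 'M[F]_n) (z : F) :
  (char_poly M).[z] = \det (z%:M - M).
Proof.
rewrite /char_poly -horner_evalE -det_map_mx; congr (\det _).
apply/matrixP => i j; rewrite !mxE /= /horner_eval !hornerE.
by case: (i == j); rewrite ?mulr1n ?mulr0n ?hornerX ?horner0.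
Qed.

(** Factoring [g] into linear factors reduces this to [det (M - z)], which is the characteristic
    polynomial at [z] up to sign; the two products are then exchanged. *)
Lemma det_horner_mx (F : closedFieldType) n (M : 'M[F]_n.+1) (rs : seq F) (g : {poly F}) :
  char_poly M = \prod_(r <- rs) ('X - r%:P) ->
  \det (horner_mx M g) = \prod_(r <- rs) g.[r].
Proof.
move=> cM; have szr : size rs = n.+1.
  by apply: succn_inj; rewrite -(size_prod_XsubC rs id) -cM size_char_poly.
have dX z : \det (horner_mx M ('X - z%:P)) = \prod_(r <- rs) (r - z).
  rewrite rmorphB/= horner_mx_X horner_mx_C -opprB -scaleN1r detZ -horner_char_poly cM.
  rewrite horner_prod -szr -[LHS]mulrC.
  elim: (rs) => [|r s IH]; first by rewrite !big_nil mulr1.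
  by rewrite !big_cons -IH /= exprS hornerXsubC; ring.
have [s gE] := closed_field_poly_normal g.
rewrite gE horner_mxZ detZ rmorph_prod/= (big_morph _ (@detM _ _) (det1 _ _)).
under eq_bigr do rewrite dX.
rewrite exchange_big/= -szr; elim: (rs) => [|r t IH]; first by rewrite !big_nil mulr1.
rewrite !big_cons -IH /= exprS hornerZ horner_prod.
under [in RHS]eq_bigr do rewrite hornerXsubC.
by ring.
Qed.

Lemma integral_prod (R K : comNzRingType) (f : {rmorphism R -> K}) (I : eqType)
    (s : seq I) (F : I -> K) :
  (forall i, i \in s -> integralOver f (F i)) -> integralOver f (\prod_(i <- s) F i).
Proof.
move=> h; rewrite big_seq; apply: big_ind => //; first exact: integral1.
exact: integral_mul.
Qed.

(** By Gauss's lemma the primitive linear polynomial vanishing at [q] divides [h] over the integers,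
    so its leading coefficient divides [1]. *)
Lemma rat_root_monic_int (h : {poly int}) (q : rat) :
  h \is monic -> root (map_poly intr h) q -> exists m : int, q = m%:~R.
Proof.
move=> hm hq.
pose p : {poly int} := denq q *: 'X - (numq q)%:P.
have pE : map_poly intr p = (denq q)%:~R *: ('X - q%:P) :> {poly rat}.
  rewrite /p rmorphB/= map_polyZ/= map_polyX map_polyC/= scalerBr; congr (_ - _).
  by rewrite -mul_polyC -polyCM mulrC numqE.
have : map_poly (intr : int -> rat) p %| map_poly intr h.
  by rewrite pE dvdpZl ?intr_eq0 ?denq_neq0// dvdp_XsubCl.
rewrite dvdp_rat_int => /dvdpP_int[r hE].
have l1 : lead_coef (zprimitive p) * lead_coef r = 1.
  by rewrite -lead_coefM -hE; apply/eqP.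
have c0 : zcontents p != 0.
  rewrite zcontents_eq0; apply/eqP => p0; move: pE; rewrite p0 rmorph0 => /esym/eqP.
  by rewrite scaler_eq0 intr_eq0 (negbTE (denq_neq0 q))/= polyXsubC_eq0.
have sp : size (zprimitive p) = 2%N.
  rewrite size_zprimitive -(size_map_inj_poly (f := intr : int -> rat))//; last exact: intr_inj.
  by rewrite pE size_scale ?size_XsubC// intr_eq0 denq_neq0.
have : (map_poly intr (zprimitive p)).[q] = 0.
  have : (map_poly intr p).[q] = 0 by rewrite pE !hornerE subrr mulr0.
  rewrite {1}[p]zpolyEprim map_polyZ/= hornerZ => /eqP.
  by rewrite mulf_eq0 intr_eq0 (negbTE c0) => /eqP.
rewrite horner_coef size_map_inj_poly//; last exact: intr_inj.
rewrite sp !big_ord_recl big_ord0 !coef_map/= expr0 expr1 mulr1 addr0.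
move: l1; rewrite lead_coefE sp /= => l1 e.
(* The root of [a1 X + a0] is [- a0 / a1], and [l1] makes [lead_coef r] the inverse of [a1]. *)
exists (- (zprimitive p)`_0 * lead_coef r).
rewrite rmorphM rmorphN/=.
have -> : - ((zprimitive p)`_0)%:~R = ((zprimitive p)`_1)%:~R * q.
  by apply/eqP; rewrite eq_sym -addr_eq0 addrC e.
by rewrite mulrAC -rmorphM/= l1 mul1r.
Qed.

Section NumberField.
Variables (F : numClosedFieldType) (f : {poly rat}) (g0 : F).
Hypothesis fmonic : f \is monic.
Hypothesis fsize : (1 < size f)%N.
Hypothesis froot : root f^ratr g0.
Hypothesis fmin : forall q : {poly rat}, root q^ratr g0 -> f %| q.

Variable rs : seq F.
Hypothesis frs : f^ratr = \prod_(r <- rs) ('X - r%:P).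

Lemma mem_roots_min : g0 \in rs.
Proof. by rewrite -root_prod_XsubC -frs. Qed.

Lemma size_roots_min : size rs = (size f).-1.
Proof. by rewrite -(size_map_poly (ratr : {rmorphism rat -> F})) frs size_prod_XsubC. Qed.

(** Write [f = h * gcdp f q]. If [g0] is a root of [h], minimality makes the gcd constant; if it is
    a root of the gcd, it is a root of [q]. *)
Lemma coprime_min (q : {poly rat}) : ~~ root q^ratr g0 -> coprimep f q.
Proof.
move=> q0; have := dvdp_gcdl f q => /dvdpP[h fE].
rewrite /coprimep; have : root (h * gcdp f q)^ratr g0 by rewrite -fE.
rewrite rmorphM/= rootM => /orP[/fmin fh|/fmin fg]; last first.
  have := dvdp_trans fg (dvdp_gcdr f q) => /dvdpP[k qE].
  by move: q0; rewrite qE rmorphM/= rootM froot orbT.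
have f0 : f != 0 by rewrite monic_neq0.
have hg0 : h * gcdp f q != 0 by rewrite -fE.
move: (hg0); rewrite mulf_eq0 negb_or => /andP[h0 gg0].
have sf : size f = (size h + size (gcdp f q)).-1 by rewrite {1}fE size_mul.
have := dvdp_leq h0 fh; rewrite sf => le.
have h1 : (0 < size h)%N by rewrite size_poly_gt0.
have g1 : (0 < size (gcdp f q))%N by rewrite size_poly_gt0.
apply/eqP; move: le h1 g1; clear; move: (size (gcdp f q)) (size h) => x y. lia.
Qed.

(** A polynomial not vanishing at [g0] is coprime to [f], so it vanishes at no root of [f]. *)
Lemma root_min_conj (q : {poly rat}) r : r \in rs -> root q^ratr g0 = root q^ratr r.
Proof.
move=> rrs; have fr : root f^ratr r by rewrite frs root_prod_XsubC.
apply/idP/idP => [/fmin/dvdpP[h ->]|qr]; first by rewrite rmorphM/= rootM fr orbT.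
apply: contraLR qr => /coprime_min; rewrite -(coprimep_map (ratr : {rmorphism rat -> F})).
by move/coprimep_root => /(_ _ fr).
Qed.

(** This makes the embedding of [Q(g0)] sending [g0] to [r] well defined. *)
Lemma eval_min_conj (p q : {poly rat}) r : r \in rs ->
  p^ratr.[g0] = q^ratr.[g0] -> p^ratr.[r] = q^ratr.[r].
Proof.
move=> rrs e; apply/eqP; rewrite -subr_eq0 -hornerN -hornerD -rmorphB/=.
rewrite -[_ == 0]/(root _ r) -root_min_conj// /root rmorphB/= hornerD hornerN e.
by rewrite subrr.
Qed.

(** Polynomial expressions already form the field [Q(g0)]: [infield_inv] inverts them by Bezout. *)
Definition infield (z : F) : Prop := exists q : {poly rat}, z = q^ratr.[g0].

Lemma infield_inv z : infield z -> infield z^-1.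
Proof.
move=> [q ->]; have [q0|q0] := eqVneq q^ratr.[g0] 0.
  by exists 0; rewrite q0 invr0 rmorph0 horner0.
have /Bezout_eq1_coprimepP[[u v] /= uv] : coprimep f q by apply: coprime_min.
exists v; apply: (mulIf q0); rewrite mulVf// -hornerM -rmorphM/=.
have -> : v * q = 1 - u * f by rewrite -uv; ring.
by rewrite rmorphB rmorphM rmorph1/= hornerD hornerN hornerM (rootP froot) mulr0 subr0 hornerC.
Qed.

Lemma infieldM z w : infield z -> infield w -> infield (z * w).
Proof. by move=> [p ->] [q ->]; exists (p * q); rewrite rmorphM hornerM. Qed.

Lemma infieldB z w : infield z -> infield w -> infield (z - w).
Proof. by move=> [p ->] [q ->]; exists (p - q); rewrite rmorphB hornerD hornerN. Qed.

Lemma infield_int (m : int) : infield m%:~R.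
Proof. by exists (m%:~R%:P); rewrite map_polyC/= hornerC ratr_int. Qed.

Lemma infield_gen : infield g0.
Proof. by exists 'X; rewrite map_polyX hornerX. Qed.

(** The field norm of [q(g0)], taken over the conjugates of [g0]. *)
Definition pnorm (q : {poly rat}) : F := \prod_(r <- rs) q^ratr.[r].

(* The norm is the determinant of [q] at the companion matrix of [f]. *)
Lemma pnorm_rat q : exists t : rat, pnorm q = ratr t.
Proof.
have [n [M cM]] : exists n (M : 'M[rat]_n.+1), char_poly M = f.
  have := companionmxK fmonic; move: (companionmx f).
  have : (0 < (size f).-1)%N by lia.
  case: (size f).-1 => // n _ M cM; by exists n, M.
exists (\det (horner_mx M q)); rewrite -det_map_mx map_horner_mx.
by rewrite (det_horner_mx (rs := rs))// -map_char_poly cM.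
Qed.

Lemma pnorm_eq0 q : (pnorm q == 0) = (q^ratr.[g0] == 0).
Proof.
apply/idP/idP => [|q0].
  by rewrite prodf_seq_eq0 => /hasP[r rrs /= qr]; have := root_min_conj q rrs; rewrite /root qr.
by rewrite prodf_seq_eq0; apply/hasP; exists g0 => //; exact: mem_roots_min.
Qed.

Local Notation integral := (integralOver (intr : int -> F)).

(** If [h] is monic and annihilates [q(g0)], the rational polynomial [h(q(X))] vanishes at [g0],
    hence at every conjugate. *)
Lemma integral_conj (q : {poly rat}) r : r \in rs ->
  integral q^ratr.[g0] -> integral q^ratr.[r].
Proof.
move=> rrs [h hm hr]; exists h => //; move: hr.
have hE : map_poly intr h = (map_poly (intr : int -> rat) h)^ratr :> {poly F}.
  by rewrite -map_poly_comp; apply: eq_map_poly => m; rewrite /= ratr_int.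
rewrite hE -root_comp -map_comp_poly => hr.
by rewrite -root_comp -map_comp_poly -root_min_conj.
Qed.

(** The norm is rational, and integral as a product of integral conjugates; a rational algebraic
    integer is an integer. *)
Lemma pnorm_int q : integral q^ratr.[g0] -> exists m : int, pnorm q = m%:~R.
Proof.
move=> qi; have [t tE] := pnorm_rat q.
have [h hm] : integral (pnorm q).
  by apply: (integral_prod (f := intr : {rmorphism int -> F})) => r rrs; apply: integral_conj.
rewrite tE => hr.
have [m ->] : exists m : int, t = m%:~R.
  apply: (rat_root_monic_int hm); rewrite -(fmorph_root (ratr : {rmorphism rat -> F})).
  by rewrite -map_poly_comp (eq_map_poly (g := intr))// => m; rewrite /= ratr_int.
by exists m; rewrite ratr_int.
Qed.

Definition inring (z : F) : Prop := infield z /\ integral z.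

Lemma inringM z w : inring z -> inring w -> inring (z * w).
Proof.
move=> [kz iz] [kw iw]; split; first exact: infieldM.
exact: (integral_mul (RtoK := intr : {rmorphism int -> F})).
Qed.

Lemma inringB z w : inring z -> inring w -> inring (z - w).
Proof.
move=> [kz iz] [kw iw]; split; first exact: infieldB.
exact: (integral_sub (RtoK := intr : {rmorphism int -> F})).
Qed.

Lemma inring_int (m : int) : inring m%:~R.
Proof.
split; first exact: infield_int.
exact: (integral_id (intr : {rmorphism int -> F})).
Qed.

Lemma inring_prod (s : seq F) :
  (forall z, z \in s -> inring z) -> inring (\prod_(z <- s) z).
Proof.
move=> h; rewrite big_seq; apply: big_ind => //; first exact: (inring_int 1).
exact: inringM.
Qed.

(** A representing polynomial is picked by [xget]; [knormE] shows that the choice is immaterial. *)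
Definition knorm (z : F) : F := pnorm (xget 0 [set q : {poly rat} | z = q^ratr.[g0]]).

Lemma knormE q : knorm q^ratr.[g0] = pnorm q.
Proof.
rewrite /knorm; case: xgetP => [p _ /= pE|/(_ q)/=]; last by [].
by apply: eq_big_seq => r rrs; apply: eval_min_conj.
Qed.

Lemma knormM z w : infield z -> infield w -> knorm (z * w) = knorm z * knorm w.
Proof.
move=> [p ->] [q ->]; rewrite -hornerM -rmorphM !knormE /pnorm -big_split/=.
by apply: eq_bigr => r _; rewrite rmorphM hornerM.
Qed.

Lemma knorm_int (m : int) : knorm m%:~R = m%:~R ^+ size rs.
Proof.
have mE (r : F) : ((m%:~R)%:P : {poly rat})^ratr.[r] = m%:~R.
  by rewrite map_polyC hornerC/= ratr_int.
rewrite -{1}(mE g0) knormE /pnorm; under eq_bigr do rewrite mE.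
by rewrite big_const_seq count_predT iter_mulr_1.
Qed.

Lemma knorm_prod (s : seq F) : (forall z, z \in s -> infield z) ->
  knorm (\prod_(z <- s) z) = \prod_(z <- s) knorm z.
Proof.
elim: s => [|z s IH] h; first by rewrite !big_nil -[1]/(1%:~R) knorm_int expr1n.
have hs : forall w, w \in s -> infield w by move=> w ws; apply: h; rewrite inE ws orbT.
rewrite !big_cons knormM ?IH//; first by apply: h; rewrite inE eqxx.
rewrite big_seq; apply: big_ind => //; first exact: (infield_int 1).
exact: infieldM.
Qed.

Lemma inring_knorm z : inring z -> exists m : int, knorm z = m%:~R.
Proof. by move=> [[q ->] qi]; rewrite knormE; apply: pnorm_int. Qed.

Lemma knorm_eq0 z : infield z -> (knorm z == 0) = (z == 0).
Proof. by move=> [q ->]; rewrite knormE pnorm_eq0. Qed.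

(** The cofactor is the product of the other conjugates, hence integral, and it lies in the field as
    the quotient [knorm z / z]. *)
Lemma dvd_knorm z : inring z -> z != 0 -> exists2 w, inring w & z * w = knorm z.
Proof.
move=> zO z0; have [m mE] := inring_knorm zO; exists (knorm z / z); last first.
  by rewrite mulrC divfK.
split; first by rewrite mE; apply: infieldM; [exact: infield_int|apply: infield_inv zO.1].
have [[q zE] qi] := zO; rewrite zE in z0 qi *.
rewrite knormE /pnorm (perm_big _ (perm_to_rem mem_roots_min)) big_cons /=.
rewrite [X in X / _]mulrC mulfK//.
apply: (integral_prod (f := intr : {rmorphism int -> F})) => r /mem_rem rrs.
exact: integral_conj.
Qed.

Lemma knorm_ge1 z : inring z -> z != 0 -> 1 <= `|knorm z|.
Proof.
move=> zO z0; have [m mE] := inring_knorm zO.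
have := knorm_eq0 zO.1; rewrite (negbTE z0) mE intr_eq0 => m0.
by rewrite -intr_norm -[1]/(1%:~R) ler_int; lia.
Qed.

(** * Units of the ring of integers *)

Local Notation unit := (unit_in inring).
Local Notation irr := (irreducible_in inring).

Lemma unit_inM u v : unit u -> unit v -> unit (u * v).
Proof.
move=> [Ou [u' [Ou' uu]]] [Ov [v' [Ov' vv]]]; split; first exact: inringM.
by exists (u' * v'); split; [exact: inringM|rewrite mulrACA uu vv mulr1].
Qed.

Lemma unit_in1 : unit 1.
Proof. by split; [exact: (inring_int 1)|exists 1; split; [exact: (inring_int 1)|rewrite mulr1]]. Qed.

Lemma unit_in_neq0 u : unit u -> u != 0.
Proof. by move=> [_ [v [_ uv]]]; apply: contra_eq_neq uv => ->; rewrite mul0r eq_sym oner_neq0. Qed.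

Lemma unit_inV u : unit u -> unit u^-1.
Proof.
move=> uu; have u0 := unit_in_neq0 uu; move: uu => [Ou [v [Ov uv]]].
have -> : u^-1 = v by apply: (mulfI u0); rewrite uv divff.
by split => //; exists u; split => //; rewrite mulrC.
Qed.

Lemma unit_inX u (k : int) : unit u -> unit (u ^ k).
Proof.
move=> uu; have pw n : unit (u ^+ n).
  elim: n => [|n IH]; first by rewrite expr0; exact: unit_in1.
  by rewrite exprS; apply: unit_inM.
by case: k => n; [exact: pw|apply: unit_inV; exact: pw].
Qed.

Lemma knorm1_unit z (m : int) : inring z -> knorm z = m%:~R -> `|m|%N = 1%N -> unit z.
Proof.
move=> zO mE m1.
have z0 : z != 0 by rewrite -(knorm_eq0 zO.1) mE intr_eq0; lia.
have [w wO zw] := dvd_knorm zO z0; split => //; exists (w * m%:~R); split.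
  by apply: inringM => //; exact: inring_int.
by rewrite mulrA zw mE -rmorphM/= (_ : m * m = 1)//; lia.
Qed.

(** The norm of [p] is a positive power of [p], while the norms of [p] and of an inverse would be
    integers with product [1]. *)
Lemma prime_not_unit p : prime p -> ~ unit p%:R.
Proof.
move=> pp [pO [v [vO pv]]].
have [m mE] := inring_knorm vO.
have k1 : knorm 1 = 1 by rewrite -[X in knorm X]/(1%:~R) knorm_int expr1n.
have kp : knorm p%:R = p%:~R ^+ size rs by rewrite -[X in knorm X]/(p%:~R) knorm_int.
have := knormM pO.1 vO.1; rewrite pv k1 kp mE -rmorphXn -rmorphM/= => /eqP.
rewrite -[X in X == _]/(1%:~R) eqr_int => /eqP h.
have := congr1 absz h; rewrite abszM abszX => /esym/eqP; rewrite muln_eq1 => /andP[].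
rewrite absz_nat => /eqP e1 _; have := ltn_expl (size rs) (prime_gt1 pp).
by rewrite e1 size_roots_min; lia.
Qed.

(** * Unique factorization and elements of smooth norm *)

Hypothesis hufd : is_ufd inring.

Lemma irr_inring s : irreducible_seq inring s -> forall z, z \in s -> inring z.
Proof. by move=> si z /si[]. Qed.

Lemma irr_prod_neq0 s : irreducible_seq inring s -> \prod_(z <- s) z != 0.
Proof.
by move=> si; rewrite prodf_seq_neq0; apply/allP => z /si[_ z0 _ _] /=; apply/eqP.
Qed.

(** The norms of the irreducible factors multiply to [p ^ size rs] up to sign, and each is at least
    [p] in absolute value because norm [1] or [-1] would give a unit. *)
Lemma prime_factors p : prime p -> exists s,
  [/\ irreducible_seq inring s, p%:R = \prod_(z <- s) z & (size s <= size rs)%N].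
Proof.
move=> pp; have pO : inring p%:R := inring_int p.
have p0 : p%:R <> 0 :> F by apply/eqP; rewrite pnatr_eq0; have := prime_gt0 pp; lia.
have [s [si pE]] := hufd.1 _ pO p0 (prime_not_unit pp).
exists s; split => //.
have /choice[nn nE] : forall z, exists m : int, z \in s -> knorm z = m%:~R.
  move=> z; have [zs|zs] := boolP (z \in s); last by exists 0.
  by have [m mE] := inring_knorm (irr_inring si zs); exists m.
have pr : (\prod_(z <- s) `|nn z| = p ^ size rs)%N.
  have : \prod_(z <- s) nn z = p%:Z ^+ size rs.
    apply: (@intr_inj F); rewrite rmorph_prod rmorphXn/= -[RHS]knorm_int.
    rewrite -[p%:~R]/(p%:R : F) pE knorm_prod; last by move=> z /(irr_inring si)[].
    by apply: eq_big_seq => z zs; rewrite nE.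
  move/(congr1 absz); rewrite abszX/= => <-.
  by rewrite (big_morph absz abszM (erefl : absz 1 = 1%N)).
have ge z : z \in s -> (p <= `|nn z|)%N.
  move=> zs; have : (`|nn z| %| p ^ size rs)%N.
    by rewrite -pr (perm_big _ (perm_to_rem zs)) big_cons /= dvdn_mulr.
  move/(dvdn_pfactor _ _ pp) => [[|e] _ eE]; last first.
    by rewrite eE expnS leq_pmulr// expn_gt0 prime_gt0.
  have [zO _ nu _] := si _ zs.
  by case: nu; apply: (knorm1_unit zO (nE _ zs)); rewrite eE.
have : (p ^ size s <= p ^ size rs)%N.
  rewrite -pr; elim: (s) ge => [|z t IH] ge; first by rewrite big_nil.
  rewrite big_cons expnS leq_mul//; first by apply: ge; rewrite inE eqxx.
  by apply: IH => w wt; apply: ge; rewrite inE wt orbT.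
by rewrite leq_exp2l// prime_gt1.
Qed.

(** Uniqueness is applied to [q] followed by a factorization of [w], or to the irreducible [q * w]
    alone when [w] is a unit. *)
Lemma irr_dvd_assoc q w t : irr q -> inring w -> irreducible_seq inring t ->
  q * w = \prod_(z <- t) z -> exists2 z, z \in t & associated_in inring q z.
Proof.
move=> qi wO ti qw.
have w0 : w <> 0.
  by move=> w0; have := irr_prod_neq0 ti; rewrite -qw w0 mulr0 eqxx.
have [wu|wu] := pselect (unit w).
  have si : irreducible_seq inring [:: q * w].
    move=> z; rewrite inE => /eqP ->; have [qO q0 qu qq] := qi; split.
    - exact: inringM.
    - by apply/eqP; rewrite mulf_neq0//; apply/eqP.
    - move=> qwu; apply: qu; have -> : q = q * w * w^-1 by rewrite mulfK//; apply/eqP.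
      by apply: unit_inM => //; apply: unit_inV.
    move=> b c bO cO e; have := qq (b * w^-1) c.
    have w'u := unit_inV wu.
    have -> : q = b * w^-1 * c.
      by rewrite mulrAC -e mulfK//; apply/eqP.
    case=> // [||h]; [exact: (inringM bO w'u.1)|left|by right].
    have -> : b = b * w^-1 * w by rewrite mulfVK//; apply/eqP.
    exact: unit_inM.
  have [|t' [tt st h]] := hufd.2 _ _ si ti; first by rewrite big_seq1.
  have t'0 : t'`_0 \in t by rewrite (perm_mem tt) mem_nth// -st.
  exists t'`_0 => //; have [u [uu /= ->]] := h 0%N isT.
  by exists (u * w); split; [exact: unit_inM|ring].
have [s [si wE]] := hufd.1 _ wO w0 wu.
have qsi : irreducible_seq inring (q :: s).
  by move=> z; rewrite inE => /orP[/eqP ->|/si].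
have [|t' [tt st h]] := hufd.2 _ _ qsi ti; first by rewrite big_cons -wE.
have t'0 : t'`_0 \in t by rewrite (perm_mem tt) mem_nth// -st.
by exists t'`_0 => //; exact: (h 0%N).
Qed.

Lemma prod_assoc_expo (s ps : seq F) :
  (forall q, q \in s -> exists2 z, z \in ps & associated_in inring q z) ->
  exists (v : F) (e : 'I_(size ps) -> nat), unit v /\
    \prod_(q <- s) q = v * \prod_(j < size ps) ps`_j ^+ e j.
Proof.
elim: s => [|q s IH] h.
  exists 1, (fun=> 0%N); split; first exact: unit_in1.
  by rewrite big_nil mul1r big1.
have [|v [e [vu sE]]] := IH; first by move=> z zs; apply: h; rewrite inE zs orbT.
have [|z zps [u [uu zE]]] := h q; first by rewrite inE eqxx.
have zi : (index z ps < size ps)%N by rewrite index_mem.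
(* [q] is recorded at the position of its associate [z], and the discrepancy goes into the unit. *)
exists (v * u^-1), (fun j => e j + (j == Ordinal zi))%N; split.
  by apply: unit_inM => //; apply: unit_inV.
rewrite big_cons sE.
have -> : q = u^-1 * z by rewrite zE mulKf// unit_in_neq0.
under [in RHS]eq_bigr do rewrite exprD.
rewrite big_split/= [X in _ = _ * (_ * X)](bigD1 (Ordinal zi))//= eqxx expr1 nth_index//.
rewrite [X in _ = _ * (_ * (_ * X))]big1; first by ring.
by move=> j /negbTE ->.
Qed.

Lemma smooth_nat_factors (ps : seq F) (X m : nat) :
  (forall p, prime p -> (p <= X)%N -> exists s,
     [/\ irreducible_seq inring s, {subset s <= ps} & p%:R = \prod_(z <- s) z]) ->
  (0 < m)%N -> (forall p, prime p -> (p %| m)%N -> (p <= X)%N) ->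
  exists s, [/\ irreducible_seq inring s, {subset s <= ps} & m%:R = \prod_(z <- s) z].
Proof.
move=> hp; have [n] := ubnP m; elim: n m => // n IH m mn m0 hm.
have [m1|m1] := leqP m 1.
  by exists [::]; split => //; rewrite big_nil (_ : m = 1%N)//; lia.
have pp := pdiv_prime m1; have pm := pdiv_dvd m.
have [s [si sps sE]] := hp _ pp (hm _ pp pm).
have mE := divnK pm.
have [|||t [ti tps tE]] := IH (m %/ pdiv m)%N.
- by have := prime_gt1 pp; nia.
- by have := prime_gt1 pp; nia.
- by move=> p pr pd; apply: hm => //; rewrite -mE dvdn_mulr.
exists (t ++ s); split.
- by move=> z; rewrite mem_cat => /orP[/ti|/si].
- by move=> z; rewrite mem_cat => /orP[/tps|/sps].
by rewrite big_cat/= -tE -sE -natrM mE.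
Qed.

(** [ps] lists the irreducible factors of all primes up to [X]. An irreducible factor of [z] divides
    the norm of [z], hence a product of elements of [ps], and so is associated to one of them. *)
Lemma smooth_factorization (X : nat) : exists ps : seq F,
  [/\ (size ps <= size rs * prime_count X)%N,
      0 \notin ps &
  forall z (m : int), inring z -> z != 0 -> knorm z = m%:~R ->
    (forall p, prime p -> (p %| `|m|)%N -> (p <= X)%N) ->
    exists (v : F) (e : 'I_(size ps) -> nat), unit v /\
      z = v * \prod_(j < size ps) ps`_j ^+ e j].
Proof.
have /choice[fs fsP] : forall p, exists s, prime p ->
    [/\ irreducible_seq inring s, p%:R = \prod_(z <- s) z & (size s <= size rs)%N].
  move=> p; have [pp|pp] := boolP (prime p); last by exists [::].
  by have [s sP] := prime_factors pp; exists s.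
exists (flatten [seq fs p | p <- [seq p <- index_iota 0 X.+1 | prime p]]); split.
- rewrite /prime_count size_flatten sumnE /shape -map_comp big_map big_filter big_distrr/=.
  by apply: leq_sum => p /fsP[_ _]; rewrite muln1.
- apply/negP => /flattenP[l /mapP[p]]; rewrite mem_filter => /andP[/fsP[fi _ _] _] -> /fi.
  by case.
move=> z m zO z0 zm hm; set ps := flatten _.
have [zu|zu] := pselect (unit z).
  by exists z, (fun=> 0%N); split => //; rewrite big1 ?mulr1.
have [s [si sE]] := hufd.1 _ zO (elimN eqP z0) zu.
rewrite sE; apply: prod_assoc_expo => q qs.
have m0 : (0 < `|m|)%N.
  by rewrite absz_gt0; have := knorm_eq0 zO.1; rewrite zm intr_eq0 (negbTE z0) => ->.
have [t [ti tps tE]] : exists t, [/\ irreducible_seq inring t, {subset t <= ps} &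
    `|m|%N%:R = \prod_(z <- t) z].
  apply: (smooth_nat_factors (X := X)) => // p pp pX.
  have [fi fE _] := fsP _ pp; exists (fs p); split => // w wf.
  apply/flattenP; exists (fs p) => //; apply/mapP; exists p => //.
  by rewrite mem_filter pp mem_index_iota/=.
have [w wO zw] := dvd_knorm zO z0.
(* The sign turns the norm [m] into [|m|], the natural number that has been factored. *)
pose w' := \prod_(y <- rem q s) y * w * (Num.sg m)%:~R.
have qw : q * w' = \prod_(y <- t) y.
  rewrite -tE /w' !mulrA; move: sE; rewrite (perm_big _ (perm_to_rem qs)) big_cons/= => <-.
  rewrite zw zm -rmorphM/= mulrC -normrEsg.
  by rewrite -abszE.
have [|y yt qy] := irr_dvd_assoc (si _ qs) _ ti qw; last by exists y => //; exact: tps.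
apply: inringM; last exact: inring_int.
apply: inringM => //; apply: inring_prod => y /mem_rem; exact: irr_inring.
Qed.

End NumberField.

(** * Independence of the non-smooth shifts *)

(** Positive and negative parts of an exponent: with them, a multiplicative relation becomes an
    identity between polynomial values. *)
Definition zpos (k : int) : nat := if 0 <= k then `|k|%N else 0%N.
Definition zneg (k : int) : nat := if 0 <= k then 0%N else `|k|%N.

Lemma exprz_zpos (F : fieldType) (x : F) k :
  x != 0 -> x ^ k * x ^+ zneg k = x ^+ zpos k.
Proof.
move=> x0; rewrite -[x ^+ zneg k]/(x ^ Posz _) -expfzDr//.
have -> // : k + (zneg k)%:Z = (zpos k)%:Z.
by rewrite /zpos /zneg; case: ifP; lia.
Qed.

Lemma ReMz (R : realType) (k : int) (z : R[i]) :
  complex.Re (k%:~R * z) = k%:~R * complex.Re z.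
Proof. by case: z => x y; rewrite !mulrzl raddfMz. Qed.

Lemma ImMz (R : realType) (k : int) (z : R[i]) :
  complex.Im (k%:~R * z) = k%:~R * complex.Im z.
Proof. by case: z => x y; rewrite !mulrzl raddfMz. Qed.

Lemma normc_lt1 (R : realType) (z : R[i]) :
  (`|z| < 1) = (ComplexField.Normc.normc z < 1).
Proof. by case: z => x y; rewrite normc_def -[1]/(1%:C)%C ltcR. Qed.

Lemma prod_norm_lt1 (R : numDomainType) (I : eqType) (s : seq I) (F : I -> R) :
  (0 < size s)%N -> (forall i, i \in s -> `|F i| < 1) -> `|\prod_(i <- s) F i| < 1.
Proof.
elim: s => // i s IH _ h; rewrite big_cons normrM.
have h0 : `|F i| < 1 by apply: h; rewrite inE eqxx.
case: s IH h => [|j s] IH h; first by rewrite big_nil normr1 mulr1.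
apply: mulr_ilt1 => //; apply: IH => // l ls; apply: h; by rewrite inE ls orbT.
Qed.

Lemma int_norm_lt1 (R : numDomainType) (m : int) : `|m%:~R : R| < 1 -> m = 0.
Proof. by rewrite -intr_norm -[1]/(1%:~R) ltr_int; lia. Qed.

(** The factor at [i = m] has exponent [0], and every other base is nonzero of absolute value below
    [N <= p]. *)
Lemma prime_ndvd_shifts N (S : {set 'I_N}) (b : 'I_N -> nat) (m : 'I_N) p :
  prime p -> (N <= p)%N -> b m = 0%N ->
  ~~ (p %| `|(\prod_(i in S) (i%:Z - m%:Z) ^+ b i)%R|)%N.
Proof.
move=> pp Np bm; apply: (big_ind (fun x : int => ~~ (p %| `|x|)%N)) => [|x y xp yp|i iS].
- by rewrite dvdn1; apply: contraTneq pp => ->.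
- by rewrite abszM Euclid_dvdM// negb_or xp.
rewrite abszX Euclid_dvdX// negb_and; have [im|im] := eqVneq i m.
  by rewrite im bm orbT.
apply/orP; left; rewrite gtnNdvd//.
  by rewrite absz_gt0 subr_eq0; move: im; rewrite -val_eqE.
have := ltn_ord i; have := ltn_ord m; lia.
Qed.

Lemma nonsmooth_free (R : realType) (g : R[i]) (P : {poly int}) N (S : {set 'I_N}) :
  (forall n : nat, n%:R - g != 0) ->
  (forall G : {poly int}, root (map_poly intr G) g -> exists Q, G = P * Q) ->
  (forall i, i \in S -> exists p, [/\ prime p, (N <= p)%N & (p %| `|P.[i%:Z]|)%N]) ->
  Qfree_on (fun i : 'I_N => clog (i%:R - g)) S.
Proof.
move=> ng hP hS c c0 m mS.
have [D [k [D0 kE]]] := clear_denominators c.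
have lk : \sum_(i in S) (k i)%:~R * clog (i%:R - g) = 0.
  transitivity (D%:R * \sum_(i in S) ratr (c i) * clog (i%:R - g)).
    rewrite mulr_sumr; apply: eq_bigr => i _.
    by rewrite mulrA -(ratr_int _ (k i)) -kE rmorphM/= ratr_nat [D%:R * _]mulrC.
  by rewrite c0 mulr0.
have := congr1 (@cexp R) lk; rewrite cexp0 cexp_sum => ek.
have {}ek : \prod_(i in S) (i%:R - g) ^+ zpos (k i) = \prod_(i in S) (i%:R - g) ^+ zneg (k i).
  rewrite -[RHS]mul1r -[X in _ = X * _]ek -big_split/=; apply: eq_bigr => i _.
  by rewrite cexpMz cexp_clog// exprz_zpos.
pose X (i : 'I_N) : {poly int} := (i%:Z)%:P - 'X.
(* The exponentiated relation says that [G] vanishes at [g], so [P] divides [G] over the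
   integers. *)
pose G := \prod_(i in S) X i ^+ zpos (k i) - \prod_(i in S) X i ^+ zneg (k i).
have Xg i : (map_poly intr (X i)).[g] = i%:R - g.
  by rewrite rmorphB/= map_polyC map_polyX/= hornerD hornerN hornerC hornerX.
have prodg b : (map_poly intr (\prod_(i in S) X i ^+ b i)).[g] = \prod_(i in S) (i%:R - g) ^+ b i.
  rewrite rmorph_prod/= horner_prod; apply: eq_bigr => i _.
  by rewrite rmorphXn/= horner_exp Xg.
have [|Q GE] := hP G.
  by rewrite /root rmorphB/= hornerD hornerN !prodg ek subrr.
have [p [pp Np pP]] := hS _ mS.
have pG : (p %| `|G.[m%:Z]|)%N by rewrite GE hornerM abszM dvdn_mulr.
have prodm b : (\prod_(i in S) X i ^+ b i).[m%:Z] = \prod_(i in S) (i%:Z - m%:Z) ^+ b i.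
  rewrite horner_prod; apply: eq_bigr => i _.
  by rewrite horner_exp hornerD hornerN hornerC hornerX.
have prod0 b : (0 < b m)%N -> \prod_(i in S) (i%:Z - m%:Z) ^+ b i = 0.
  by move=> bm; rewrite (bigD1 m)//= subrr expr0n eqn0Ngt bm mul0r.
have [km|km] := eqVneq (k m) 0.
  have /eqP := kE m; rewrite km mulf_eq0 pnatr_eq0 => /orP[/eqP//|]; lia.
move: pG; rewrite /G hornerD hornerN !prodm.
(* Exactly one of [zpos (k m)] and [zneg (k m)] is positive: that product vanishes at [m], and [p]
   does not divide the other. *)
have [k0|k0] := leP 0 (k m).
  rewrite prod0; last by rewrite /zpos k0 absz_gt0.
  rewrite sub0r abszN (negbTE (prime_ndvd_shifts _ _ _ _))//.
  by rewrite /zneg k0.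
rewrite [X in _ - X]prod0; last by rewrite /zneg leNgt k0 absz_gt0.
rewrite subr0 (negbTE (prime_ndvd_shifts _ _ _ _))//.
by rewrite /zpos leNgt k0.
Qed.

(** * Rank of the smooth shifts *)

Lemma prod_exprz_sum (F : fieldType) (I : Type) (r : seq I) (x : F) (k : I -> int) :
  x != 0 -> \prod_(i <- r) x ^ k i = x ^ (\sum_(i <- r) k i).
Proof.
move=> x0; elim: r => [|i r IH]; first by rewrite !big_nil expr0z.
by rewrite !big_cons IH expfzDr.
Qed.

Section ConjugateShifts.
Variables (F : numClosedFieldType) (f : {poly rat}) (g : F) (rs : seq F).
Hypothesis fmonic : f \is monic.
Hypothesis froot : root f^ratr g.
Hypothesis fmin : forall q : {poly rat}, root q^ratr g -> f %| q.
Hypothesis frs : f^ratr = \prod_(r <- rs) ('X - r%:P).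
Hypothesis gnat : forall n : nat, n%:R - g != 0.

Lemma shift_polyE (n : nat) (r : F) : ((n%:R)%:P - 'X : {poly rat})^ratr.[r] = n%:R - r.
Proof. by rewrite rmorphB/= map_polyC map_polyX hornerD hornerN hornerC hornerX/= ratr_nat. Qed.

Lemma shift_conj_neq0 (n : nat) r : r \in rs -> n%:R - r != 0.
Proof.
move=> rrs; have := root_min_conj fmonic froot fmin frs ((n%:R)%:P - 'X) rrs.
by rewrite /root !shift_polyE (negbTE (gnat n)) => /esym/negbT.
Qed.

(** Moving the negative powers to the other side leaves an identity between rational polynomials at
    [g], which [eval_min_conj] carries over to [r]. *)
Lemma shifts_conj (I : finType) (n : I -> nat) (k : I -> int) (q : {poly rat}) r :
  r \in rs -> q^ratr.[g] = \prod_i ((n i)%:R - g) ^ k i ->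
  q^ratr.[r] = \prod_i ((n i)%:R - r) ^ k i.
Proof.
move=> rrs qg; pose X i : {poly rat} := (n i)%:R%:P - 'X.
pose Y (b : int -> nat) := \prod_i X i ^+ b (k i).
have YE b (s : F) : (Y b)^ratr.[s] = \prod_i ((n i)%:R - s) ^+ b (k i).
  rewrite /Y rmorph_prod/= horner_prod; apply: eq_bigr => i _.
  by rewrite rmorphXn/= horner_exp shift_polyE.
have KE (s : F) : (forall m : nat, m%:R - s != 0) ->
    (\prod_i ((n i)%:R - s) ^ k i) * (Y zneg)^ratr.[s] = (Y zpos)^ratr.[s].
  by move=> ns; rewrite !YE -big_split/=; apply: eq_bigr => i _; apply: exprz_zpos.
have := eval_min_conj fmonic froot fmin frs (p := q * Y zneg) (q := Y zpos) rrs.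
rewrite !rmorphM/= !hornerM qg KE// => /(_ erefl).
have nr m := shift_conj_neq0 m rrs.
rewrite -(KE r)//; apply: mulIf.
by rewrite YE; apply/prodf_neq0 => i _; rewrite expf_neq0.
Qed.

End ConjugateShifts.

Section SmoothFamily.
Variables (R : realType) (f : {poly rat}) (g : R[i]) (rs : seq R[i]).
Hypothesis fmonic : f \is monic.
Hypothesis fsize : (1 < size f)%N.
Hypothesis froot : root f^ratr g.
Hypothesis fmin : forall q : {poly rat}, root q^ratr g -> f %| q.
Hypothesis frs : f^ratr = \prod_(r <- rs) ('X - r%:P).
Hypothesis hufd : is_ufd (inring g).
Hypothesis gnat : forall n : nat, n%:R - g != 0.

(** The bound counts linear forms: one per element of [ps], two per conjugate, and one for the sum
    of the [k i]. A larger free family would leave more unknowns than forms. *)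
Lemma smooth_family_bound N (S : {set 'I_N}) (c : int) (X : nat) :
  c != 0 -> inring g (c%:~R * g) ->
  (forall i, i \in S -> exists m : int, knorm g rs (c%:~R * (i%:R - g)) = m%:~R /\
     forall p, prime p -> (p %| `|m|)%N -> (p <= X)%N) ->
  Qfree_on (fun i : 'I_N => clog (i%:R - g)) S ->
  (#|S| <= size rs * prime_count X + (size rs).*2 + 1)%N.
Proof.
move=> c0 cg hS fS; rewrite leqNgt; apply/negP => big.
have [ps [psz ps0 hps]] := smooth_factorization fmonic fsize froot fmin frs hufd X.
pose I := 'I_#|S|; pose n (i : I) : nat := enum_val i.
pose z i := c%:~R * ((n i)%:R - g).
have c0' : c%:~R != 0 :> R[i] by rewrite intr_eq0.
have z0 i : z i != 0 by rewrite mulf_neq0.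
have zO i : inring g (z i).
  rewrite /z mulrBr; apply: inringB => //.
  by apply: inringM; [exact: inring_int|exact: (inring_int g (n i))].
have /choice[ve veE] : forall i, exists ve : R[i] * ('I_(size ps) -> nat),
    unit_in (inring g) ve.1 /\ z i = ve.1 * \prod_(j < size ps) ps`_j ^+ ve.2 j.
  move=> i; have [m [mE mX]] := hS _ (enum_valP i).
  by have [v [e h]] := hps (z i) m (zO i) (z0 i) mE mX; exists (v, e).
pose J := ('I_(size ps) + ('I_(size rs) + 'I_(size rs)) + unit)%type.
(* Exponents, real and imaginary parts of the logarithms of the conjugates, and
   a constant column that cancels the denominator [c]. *)
pose A (i : I) (j : J) : R := match j with
  | inl (inl j) => ((ve i).2 j)%:R
  | inl (inr (inl j)) => complex.Re (clog ((n i)%:R - rs`_j))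
  | inl (inr (inr j)) => complex.Im (clog ((n i)%:R - rs`_j))
  | inr _ => 1 end.
have JI : (#|{: J}| < #|{: I}|)%N.
  rewrite !card_sum !card_ord card_unit; apply: leq_trans big.
  by rewrite ltnS -addnn addnA leq_add2r -addnA leq_add2r.
have [e0 e00 he0] := @cexp_near1 R.
(* [e0] brings the conjugates of [u] close to [1]; the bound [1] makes the integer-valued forms
   vanish and fixes the branch of the logarithm. *)
have e1 : 0 < Num.min e0 1 by rewrite lt_min e00 ltr01.
have [k [[i0 ki0] kA]] := dirichlet_forms A e1 JI.
have kA0 j : `|\sum_i (k i)%:~R * A i j| < e0.
  by apply: lt_le_trans (kA j) _; rewrite ge_min lexx.
have kA1 j : `|\sum_i (k i)%:~R * A i j| < 1.
  by apply: lt_le_trans (kA j) _; rewrite ge_min lexx orbT.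
have ksum : \sum_i k i = 0.
  apply: (@int_norm_lt1 R); have := kA1 (inr tt); rewrite rmorph_sum/=.
  by under eq_bigr do rewrite mulr1.
have kval j : \sum_i ((ve i).2 j)%:Z * k i = 0.
  apply: (@int_norm_lt1 R); have := kA1 (inl (inl j)); rewrite rmorph_sum/=.
  by under eq_bigr do rewrite mulrC -[X in X * _]/((Posz _)%:~R) -rmorphM.
pose L r : R[i] := \sum_i (k i)%:~R * clog ((n i)%:R - r).
have expL r : r \in rs -> cexp (L r) = \prod_i ((n i)%:R - r) ^ k i.
  move=> rrs; rewrite cexp_sum; apply: eq_bigr => i _.
  by rewrite cexpMz cexp_clog// (shift_conj_neq0 fmonic froot fmin frs gnat).
have LRe r : r \in rs -> `|complex.Re (L r)| < e0.
  move=> rrs; have ri : (index r rs < size rs)%N by rewrite index_mem.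
  have := kA0 (inl (inr (inl (Ordinal ri)))); rewrite /= nth_index//.
  have -> // : \sum_i (k i)%:~R * complex.Re (clog ((n i)%:R - r)) = complex.Re (L r).
  by rewrite raddf_sum/=; apply: eq_bigr => i _; rewrite ReMz.
have LIm r : r \in rs -> `|complex.Im (L r)| < e0 /\ `|complex.Im (L r)| < 1.
  move=> rrs; have ri : (index r rs < size rs)%N by rewrite index_mem.
  have := kA0 (inl (inr (inr (Ordinal ri)))); rewrite /= nth_index//.
  have := kA1 (inl (inr (inr (Ordinal ri)))); rewrite /= nth_index//.
  have -> // : \sum_i (k i)%:~R * complex.Im (clog ((n i)%:R - r)) = complex.Im (L r).
  by rewrite raddf_sum/=; apply: eq_bigr => i _; rewrite ImMz.
have grs := mem_roots_min froot frs.
pose u := \prod_i ((n i)%:R - g) ^ k i.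
(* Since the [k i] sum to zero, the powers of [c] cancel and the shifts may be replaced by the
   [z i]; the powers of the elements of [ps] cancel by [kval]. *)
have uE : u = \prod_i (ve i).1 ^ k i.
  transitivity (\prod_i z i ^ k i).
    rewrite /z; under [in RHS]eq_bigr do rewrite expfzMl.
    by rewrite big_split/= prod_exprz_sum// ksum expr0z mul1r.
  under [in LHS]eq_bigr do rewrite (veE _).2 expfzMl.
  rewrite big_split/= [X in _ * X](_ : _ = 1) ?mulr1//.
  have -> : \prod_i (\prod_(j < size ps) ps`_j ^+ (ve i).2 j) ^ k i =
      \prod_i \prod_(j < size ps) ps`_j ^ (((ve i).2 j)%:Z * k i).
    apply: eq_bigr => i _.
    rewrite (big_morph (fun x => x ^ k i) (fun x y => expfzMl x y (k i)) (exp1rz _ _)).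
    by apply: eq_bigr => j _; rewrite -exprz_exp.
  rewrite exchange_big big1//= => j _.
  rewrite prod_exprz_sum ?kval ?expr0z//.
  by apply: contraNneq ps0 => <-; apply: mem_nth.
have [uO _] : unit_in (inring g) u.
  rewrite uE; apply: big_ind => [||i _]; first exact: unit_in1.
    exact: unit_inM.
  exact/unit_inX/(veE i).1.
(* The conjugates of [u - 1] are the [cexp (L r) - 1], all of modulus below [1], so the norm is too
   small for a nonzero algebraic integer. *)
have u1 : u = 1.
  apply/eqP; rewrite -subr_eq0; apply/negPn/negP => u1.
  have := knorm_ge1 fmonic fsize froot fmin frs (inringB uO (inring_int g 1)) u1.
  have [[q qE] _] := uO.
  have qrE r : r \in rs -> q^ratr.[r] = cexp (L r).
    by move=> rrs; rewrite expL//; apply: (shifts_conj fmonic froot fmin frs gnat) => //; rewrite -qE.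
  have -> : u - 1 = (q - 1)^ratr.[g].
    by rewrite rmorphB rmorph1 hornerD hornerN hornerC -qE.
  rewrite (knormE fmonic froot fmin frs) /pnorm lt_geF//.
  apply: prod_norm_lt1; first by case: (rs) grs.
  move=> r rrs; rewrite rmorphB rmorph1 hornerD hornerN hornerC qrE// normc_lt1.
  by apply: he0; [exact: LRe|exact: (LIm r rrs).1].
have L0 : L g = 0.
  by apply: cexp_eq1; [rewrite expL|exact: (LIm g grs).2].
have := Qfree_on_enum fS (c := fun i => (k i)%:~R) _ i0.
under eq_bigr do rewrite ratr_int.
by move=> /(_ L0) /eqP; rewrite intr_eq0 (negbTE ki0).
Qed.

End SmoothFamily.

(** * The primitive integer minimal polynomial *)

(** Needed because [Psi] counts values rather than indices. Once [m] exceeds the sum [B] of the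
    absolute values of the lower coefficients, the leading term of [P(m) - P(n)] outweighs the rest,
    as [m * (m ^ i - n ^ i) <= m ^ i.+1 - n ^ i.+1]. *)
Lemma int_poly_eventually_inj (P : {poly int}) : (2 < size P)%N ->
  exists B : nat, forall n m : nat, (n < m)%N -> (B < m)%N -> P.[n%:Z] != P.[m%:Z].
Proof.
move=> sP; have [d dE] : exists d, size P = d.+3 by exists (size P - 3)%N; lia.
pose B := (\sum_(i < d.+2) `|(P`_i)%R|)%N; exists B => n m nm Bm.
pose D i : int := m%:Z ^+ i - n%:Z ^+ i.
have D0 i : 0 <= D i by rewrite subr_ge0 lerXn2r ?nnegrE//; lia.
have DS i : m%:Z * D i <= D i.+1.
  have n0 : 0 <= n%:Z ^+ i by rewrite exprn_ge0.
  by rewrite /D mulrBr !exprS lerD2l lerN2 ler_wpM2r//; lia.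
have Dmono i j : (i <= j)%N -> D i <= D j.
  move=> /subnK <-; elim: (j - i)%N => // k IH; rewrite addSn.
  apply: le_trans IH (le_trans _ (DS _)); have := D0 (k + i)%N; nia.
have D1 : 0 < D d.+1.
  by apply: lt_le_trans (Dmono 1%N d.+1 isT); rewrite /D !expr1; lia.
rewrite eq_sym -subr_eq0 !horner_coef dE -sumrB big_ord_recr/= -mulrBr -/(D _).
set s := \sum_(i < d.+2) _.
have sB : `|s| <= B%:Z * D d.+1.
  rewrite /B (big_morph Posz PoszD (erefl (Posz 0))) mulr_suml; apply: le_trans (ler_norm_sum _ _ _) _.
  apply: ler_sum => i _; rewrite -mulrBr normrM -/(D i) (ger0_norm (D0 i)).
  by rewrite -abszE ler_wpM2l//; apply: Dmono; rewrite -ltnS.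
have lP : `|P`_d.+2| >= 1.
  have : P != 0 by rewrite -size_poly_gt0 dE.
  by rewrite -lead_coef_eq0 lead_coefE dE/=; lia.
have D2 := DS d.+1.
apply/eqP => e; have : `|P`_d.+2| * D d.+2 = `|s|.
  rewrite -(ger0_norm (D0 d.+2)) -normrM -[RHS]normrN; congr `|_|.
  by apply/eqP; rewrite -addr_eq0 addrC e.
nia.
Qed.

(** A factor of full degree leaves a constant cofactor, and primitivity forces this constant to be a
    sign. *)
Lemma irreducible_int (P : {poly int}) : (1 < size P)%N -> zprimitive P = P ->
  (forall b c : {poly int}, P = b * c -> (size b = size P) \/ (size c = size P)) ->
  irreducible_in [set: {poly int}] P.
Proof.
move=> sP Pprim hP; have P0 : P != 0 by rewrite -size_poly_gt0; lia.
have cunit (b c : {poly int}) : P = b * c -> size b = size P -> unit_in [set: {poly int}] c.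
  move=> e sb; have : b != 0 /\ c != 0.
    by apply/andP; rewrite -negb_or -mulf_eq0 -e.
  move=> [b0 c0].
  have sc : size c = 1%N.
    have := size_mul b0 c0; rewrite -e -sb; move: b0 c0; rewrite -!size_poly_gt0.
    by move: (size b) (size c) => x y; lia.
  have [k k0 cE] : exists2 k, k != 0 & c = k%:P by apply/size_poly1P; rewrite sc.
  have Pk : zprimitive P = k *: b by rewrite Pprim e cE mulrC mul_polyC.
  have kE := zprimitive_irr P0 Pk.
  split => //; exists k%:P; split => //; rewrite cE -polyCM.
  by congr (_%:P); move: k0; rewrite kE; case: sgzP.
split => //.
- exact/eqP.
- move=> [_ [v [_ Pv]]]; have v0 : v != 0.
    by apply: contra_eq_neq Pv => ->; rewrite mulr0 eq_sym oner_neq0.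
  have := size_mul P0 v0; rewrite Pv size_poly1; move: v0 sP; rewrite -size_poly_gt0.
  by move: (size P) (size v) => x y; lia.
move=> b c _ _ e; have [sb|sc] := hP b c e; first by right; apply: cunit e sb.
by left; apply: (cunit c b) sc; rewrite mulrC.
Qed.

Section IntegerMinimalPolynomial.
Variables (F : numClosedFieldType) (f : {poly rat}) (g : F).
Hypothesis fmonic : f \is monic.
Hypothesis fsize : (1 < size f)%N.
Hypothesis froot : root f^ratr g.
Hypothesis fmin : forall q : {poly rat}, root q^ratr g -> f %| q.

Lemma int_min_poly : exists P : {poly int},
  [/\ P != 0, zprimitive P = P & map_poly intr P = (lead_coef P)%:~R *: f].
Proof.
have [q [b b0 fE]] := rat_poly_scale f.
have q0 : q != 0.
  by apply: contraTneq fmonic => q0; rewrite fE q0 rmorph0 scaler0 monicE lead_coef0 eq_sym oner_eq0.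
exists (zprimitive q); split; [by rewrite zprimitive_eq0|exact: zprimitive_id|].
have zq0 : (zcontents q)%:~R != 0 :> rat by rewrite intr_eq0 zcontents_eq0.
have PE : map_poly intr (zprimitive q) = (b%:~R / (zcontents q)%:~R) *: f.
  have qE : map_poly intr q = (zcontents q)%:~R *: map_poly intr (zprimitive q) :> {poly rat}.
    by rewrite {1}[q]zpolyEprim map_polyZ.
  rewrite fE qE !scalerA.
  have b1 : b%:~R != 0 :> rat by rewrite intr_eq0.
  by rewrite [X in X *: _](_ : _ = 1) ?scale1r//; field; rewrite zq0 b1.
rewrite {1}PE; congr (_ *: _).
have := congr1 lead_coef PE; rewrite lead_coefZ (monicP fmonic) mulr1 => <-.
by rewrite lead_coef_map_inj//; exact: intr_inj.
Qed.

Variable P : {poly int}.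
Hypothesis P0 : P != 0.
Hypothesis Pprim : zprimitive P = P.
Hypothesis PE : map_poly intr P = (lead_coef P)%:~R *: f.

Let c := lead_coef P.

Lemma int_min_lead_neq0 : c%:~R != 0 :> rat.
Proof. by rewrite intr_eq0 lead_coef_eq0. Qed.

Lemma int_min_size : size P = size f.
Proof.
rewrite -(size_map_inj_poly (f := intr : int -> rat))//; last exact: intr_inj.
by rewrite PE size_scale// int_min_lead_neq0.
Qed.

Lemma map_int_ratr (G : {poly int}) :
  map_poly intr G = (map_poly (intr : int -> rat) G)^ratr :> {poly F}.
Proof. by rewrite -map_poly_comp; apply: eq_map_poly => m; rewrite /= ratr_int. Qed.

(** Gauss's lemma: [P] is primitive, so divisibility over the rationals descends to the integers. *)
Lemma int_min_dvd (G : {poly int}) : root (map_poly intr G) g ->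
  exists Q, G = P * Q.
Proof.
rewrite map_int_ratr => /fmin fG.
have /dvdpP_int[Q GE] : P %| G by rewrite -dvdp_rat_int PE dvdpZl// int_min_lead_neq0.
by exists Q; rewrite {1}GE Pprim.
Qed.

Lemma int_min_root : root (map_poly intr P) g.
Proof. by rewrite map_int_ratr PE map_polyZ /root hornerZ (rootP froot) mulr0. Qed.

(** In a factorization of [P], the factor with root [g] is a multiple of [P] and so has full
    degree. *)
Lemma int_min_irreducible : irreducible_in [set: {poly int}] P.
Proof.
apply: irreducible_int; rewrite ?int_min_size//.
have aux (b e : {poly int}) : P = b * e -> root (map_poly intr b) g -> size b = size f.
  move=> Pb /int_min_dvd[Q bE].
  have : b != 0 /\ e != 0 by apply/andP; rewrite -negb_or -mulf_eq0 -Pb.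
  move=> [b0 e0]; have Q0 : Q != 0 by apply: contraNneq b0 => Q0; rewrite bE Q0 mulr0.
  have := size_mul b0 e0; rewrite -Pb int_min_size.
  have := size_mul P0 Q0; rewrite -bE int_min_size.
  move: b0 e0 Q0; rewrite -!size_poly_gt0.
  by move: (size b) (size e) (size Q) (size f) => x y z t; lia.
move=> b e Pb; have := int_min_root; rewrite Pb rmorphM/= rootM => /orP[rb|re].
  by left; apply: aux Pb rb.
by right; apply: (aux e b) re; rewrite mulrC.
Qed.

Lemma int_min_horner (n : nat) : ratr f.[n%:R] = f^ratr.[n%:R] :> F.
Proof. by rewrite -horner_map/= ratr_nat. Qed.

Lemma lead_gen_integral : inring g (c%:~R * g).
Proof.
split; first by apply: infieldM; [exact: infield_int|exact: infield_gen].
have [d dE] : exists d, size P = d.+2.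
  by exists (size P - 2)%N; have := fsize; rewrite -int_min_size; lia.
(* [h] satisfies [h(c X) = c ^ d P(X)]. The top coefficient is given separately: it is
   [P_(d+1) / c = 1], while [d - i] would truncate to [0] there. *)
pose h : {poly int} := \poly_(i < d.+2) (if i == d.+1 then 1 else P`_i * c ^+ (d - i)).
have hsz : size h = d.+2 by rewrite size_poly_eq//= eqxx oner_neq0.
exists h; first by rewrite monicE lead_coefE hsz coef_poly/= ltnSn eqxx.
have := int_min_root; rewrite /root.
rewrite !horner_coef !size_map_inj_poly//; try exact: intr_inj.
rewrite hsz dE => /eqP Pg.
suff -> : \sum_(i < d.+2) (map_poly intr h)`_i * (c%:~R * g) ^+ i =
  c%:~R ^+ d * \sum_(i < d.+2) (map_poly intr P)`_i * g ^+ i by rewrite Pg mulr0.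
rewrite mulr_sumr; apply: eq_bigr => -[i id] _ /=.
rewrite !coef_map/= coef_poly id exprMn; case: eqP => [->|ni].
  rewrite rmorph1 mul1r /c lead_coefE dE/= exprS; ring.
rewrite rmorphM rmorphXn/=; have -> : (c%:~R ^+ d : F) = c%:~R ^+ (d - i) * c%:~R ^+ i.
  by rewrite -exprD subnK//; lia.
ring.
Qed.

Variable rs : seq F.
Hypothesis frs : f^ratr = \prod_(r <- rs) ('X - r%:P).

(** The product of the [n - r] is [f(n)], and one of the [deg f] factors [c] turns it into
    [P(n)]. *)
Lemma knorm_shift (n : nat) :
  knorm g rs (c%:~R * (n%:R - g)) = (c ^+ (size f).-2 * P.[n%:Z])%:~R.
Proof.
pose q : {poly rat} := c%:~R *: ((n%:R)%:P - 'X).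
have qE (r : F) : q^ratr.[r] = c%:~R * (n%:R - r).
  by rewrite map_polyZ/= hornerZ shift_polyE ratr_int.
rewrite -qE (knormE fmonic froot fmin frs) /pnorm.
under eq_bigr do rewrite qE.
rewrite big_split/= big_const_seq count_predT iter_mulr_1.
have -> : \prod_(r <- rs) (n%:R - r) = f^ratr.[n%:R].
  by rewrite frs horner_prod; apply: eq_bigr => r _; rewrite hornerXsubC.
rewrite (size_roots_min frs) -int_min_horner rmorphM rmorphXn/=.
have -> : (P.[n%:Z])%:~R = c%:~R * ratr f.[n%:R] :> F.
  have := congr1 (fun p : {poly rat} => p.[n%:R]) PE; rewrite hornerZ => e.
  rewrite -(ratr_int _ c) -rmorphM/= -e -(ratr_int _ P.[_]); congr ratr.
  by rewrite -horner_map/=.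
have -> : (size f).-1 = (size f).-2.+1 by move: fsize; case: (size f) => [|[|]].
by rewrite exprSr -mulrA.
Qed.

Lemma shift_neq0 (n : nat) : (2 < size f)%N -> n%:R - g != 0.
Proof.
move=> f2; apply: contraTneq f2 => e; rewrite -leqNgt.
have : f %| 'X - (n%:R)%:P.
  by apply: fmin; rewrite /root -opprB rmorphN/= hornerN shift_polyE e oppr0.
by move/dvdp_leq; rewrite size_XsubC polyXsubC_eq0; apply.
Qed.

End IntegerMinimalPolynomial.

(** * Dickman function and counting *)

Lemma asymp_equivP (R : realType) (f g : R -> R) :
  asymp_equiv f g <->
  forall e : R, 0 < e -> \forall x \near +oo, `|f x - g x| <= e * `|g x|.
Proof. exact: eqaddoP. Qed.

(** By the mean value theorem [rho] drops strictly between [1] and [2], where its derivative is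
    [- 1 / u], and does not increase afterwards because [rho] is nonnegative. *)
Lemma dickman_lt1 (R : realType) (rho : R -> R) (d : nat) :
  is_dickman rho -> (forall u, 0 < u -> 0 <= rho u) -> (2 <= d)%N -> rho d%:R < 1.
Proof.
move=> [rc r1 rd] r0 d2.
have cont (a b : R) : 0 <= a -> {within `[a, b], continuous rho}.
  move=> a0; apply: continuous_subspaceW rc => x /=; rewrite !in_itv/= => /andP[ax _].
  by rewrite andbT (le_trans a0).
have [|x||x xi e] := @MVT R rho (fun u => - rho (u - 1) / u) 1 2.
- by lra.
- by rewrite in_itv/= => /andP[x1 _]; apply: rd.
- exact: cont.
have {e} r2 : rho 2 < 1.
  move: xi; rewrite in_itv/= => /andP[x1 x2].
  have x0 : 0 < x^-1 by rewrite invr_gt0; lra.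
  move: e; rewrite (r1 1) ?ler01 ?lexx// (r1 (x - 1)); last by apply/andP; split; lra.
  by rewrite mulN1r; lra.
have [->//|d3] := eqVneq d 2%N.
apply: le_lt_trans r2.
have d2' : 2 < d%:R :> R by rewrite (ltr_nat R 2 d) ltn_neqAle eq_sym d3.
have [y||y yi e] := @MVT R rho (fun u => - rho (u - 1) / u) 2 d%:R d2'.
- by rewrite in_itv/= => /andP[y1 _]; apply: rd; lra.
- exact: cont.
move: yi; rewrite in_itv/= => /andP[y1 y2].
rewrite -subr_le0 e mulr_le0_ge0//; last by lra.
rewrite mulNr oppr_le0 divr_ge0//; last by lra.
by apply: r0; lra.
Qed.

(** Read off from the asymptotics at exponent [u / d]: a count cannot lie within relative error
    [1 / 2] of a negative quantity. *)
Lemma dickman_ge0 (R : realType) (rho : R -> R) (d : nat) (P : {poly int}) :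
  (0 < d)%N ->
  (forall u : R, 0 < u -> asymp_equiv (fun y : R => (Psi P (y `^ u) y)%:R)
                   (fun y : R => rho (d%:R * u) * y `^ u)) ->
  forall u, 0 < u -> 0 <= rho u.
Proof.
move=> d0 h u u0; rewrite leNgt; apply/negP => ru.
have dR : 0 < d%:R :> R by rewrite ltr0n.
have /asymp_equivP/(_ (1 / 2)) := h (u / d%:R) (divr_gt0 u0 dR).
have -> : d%:R * (u / d%:R) = u by rewrite mulrC divfK// gt_eqF.
case; first by lra.
move=> M [Mr hM]; pose y := Num.max M 0 + 1.
have yM : M < y by rewrite /y ltr_pwDr// le_max lexx.
have y0 : 0 < y by rewrite /y ltr_wpDl// le_max lexx orbT.
have := hM y yM; set t := y `^ _.
have t0 : 0 < t by rewrite powR_gt0.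
have rt : rho u * t < 0 by rewrite nmulr_rlt0.
have Psi0 : 0 <= (Psi P t y)%:R :> R by [].
rewrite (ltr0_norm rt) ger0_norm; lra.
Qed.

Section Counting.
Variables (R : realType) (P : {poly int}) (x : R) (N : nat).
Hypothesis NE : forall n : nat, (n%:R < x) = (n < N)%N.

(** Counts indices from [0], whereas [Psi] counts distinct values at positive indices. *)
Definition smooth_indices : {set 'I_N} := [set i : 'I_N | `[< smooth x P.[i%:Z] >]].

Let V := [set z : int | (exists n : nat, [/\ (1 <= n)%N, n%:R < x & z = P.[n%:Z]])
        /\ smooth x z].

Lemma Psi_values : V `<=` [set` [seq P.[(i : 'I_N)%:Z] | i <- enum smooth_indices]].
Proof.
move=> z [[n [n1 nx zE]] sz] /=; rewrite NE in nx.
apply/mapP; exists (Ordinal nx) => //.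
by rewrite mem_enum inE; apply/asboolP; rewrite /= -zE.
Qed.

Lemma Psi_le_smooth : (Psi P x x <= #|smooth_indices|)%N.
Proof.
have Vf : finite_set V := sub_finite_set Psi_values (finite_seq _).
rewrite cardE -(size_map (fun i : 'I_N => P.[i%:Z])).
apply: uniq_leq_size; first exact: fset_uniq.
by move=> z; rewrite (in_fset_set Vf) inE => /Psi_values.
Qed.

(** Discarding the [B + 1] indices up to [B] removes index [0] and makes [P] injective on the
    rest. *)
Lemma smooth_le_Psi B :
  (forall n m : nat, (n < m)%N -> (B < m)%N -> P.[n%:Z] != P.[m%:Z]) ->
  (#|smooth_indices| <= Psi P x x + B.+1)%N.
Proof.
move=> inj.
have Vf : finite_set V := sub_finite_set Psi_values (finite_seq _).
pose A := [set i in smooth_indices | (B < i)%N].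
have AV : (#|A| <= Psi P x x)%N.
  rewrite cardE -(size_map (fun i : 'I_N => P.[i%:Z])).
  apply: uniq_leq_size.
    rewrite map_inj_in_uniq ?enum_uniq// => i j; rewrite !mem_enum !inE.
    move=> /andP[_ Bi] /andP[_ Bj] /eqP e; apply/val_inj/eqP => /=.
    by case: ltngtP e => // ij; [rewrite (negbTE (inj _ _ ij Bj))|rewrite eq_sym (negbTE (inj _ _ ij Bi))].
  move=> z /mapP[j]; rewrite mem_enum !inE => /andP[/asboolP sj Bj] ->.
  rewrite (in_fset_set Vf) inE; split => //.
  by exists j; split => //; [lia|rewrite NE].
have : smooth_indices \subset A :|: [set i : 'I_N | (i <= B)%N].
  by apply/fintype.subsetP => i iS; rewrite finset.in_setU [i \in A]inE iS inE; case: leqP.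
move/subset_leq_card => /leq_trans; apply.
apply: leq_trans (leq_card_setU _ _) _; apply: leq_add => //.
rewrite cardE -(size_map val) -[leqRHS](size_iota 0); apply: uniq_leq_size.
  by rewrite map_inj_uniq ?enum_uniq//; exact: val_inj.
by move=> n /mapP[j]; rewrite mem_enum inE mem_iota => jB ->.
Qed.

End Counting.

(** * Passing from [a] to [- a] *)

Lemma comp_polyNXK (K : comNzRingType) (p : {poly K}) : p \Po (- 'X) \Po (- 'X) = p.
Proof. by rewrite -comp_polyA raddfN/= comp_polyX opprK comp_polyXr. Qed.

Lemma horner_ratr_compN (F : numFieldType) (p : {poly rat}) (z : F) :
  (p \Po (- 'X))^ratr.[z] = p^ratr.[- z].
Proof. by rewrite map_comp_poly horner_comp rmorphN/= map_polyX hornerN hornerX. Qed.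

Lemma alg_degreeN (R : realType) (a : R[i]) d : alg_degree a d -> alg_degree (- a) d.
Proof.
move=> [p [pm ps pr pmin]].
have s2 : size (- 'X : {poly rat}) = 2%N by rewrite size_polyN size_polyX.
have u : (-1) ^+ d != 0 :> rat by rewrite signr_eq0.
(* The sign makes [p(- X)] monic again. *)
exists ((-1) ^+ d *: (p \Po (- 'X))); split.
- rewrite monicE lead_coefZ lead_coef_comp ?s2// (monicP pm) lead_coefN lead_coefX ps mul1r.
  by rewrite -expr2 sqrr_sign.
- by rewrite size_scale// size_comp_poly2.
- by rewrite map_polyZ/= /root hornerZ horner_ratr_compN opprK (rootP pr) mulr0.
move=> q qa; rewrite dvdpZl//.
have /pmin/dvdpP[h qE] : root (q \Po (- 'X))^ratr a by rewrite /root horner_ratr_compN.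
by rewrite -(comp_polyNXK q) qE comp_polyM dvdp_mull.
Qed.

Lemma Qadjoin_infield (R : realType) (a : R[i]) d (z : R[i]) : alg_degree a d ->
  Qadjoin a z <-> infield (- a) z.
Proof.
move=> /alg_degreeN[f [fm fs fr fmin]]; split.
  move=> [p [q [q0 ->]]].
  have K (r : {poly rat}) : infield (- a) r^ratr.[a].
    by exists (r \Po (- 'X)); rewrite horner_ratr_compN opprK.
  by apply: infieldM; [exact: K|apply: (infield_inv fm fr fmin); exact: K].
move=> [q ->]; exists (q \Po (- 'X)), 1.
by rewrite rmorph1 hornerC oner_neq0 divr1 horner_ratr_compN.
Qed.

(** * Both bounds for the dimension *)

Section Bounds.
Variables (R : realType) (d : nat) (a : R[i]).
Hypothesis hd : (2 <= d)%N.
Hypothesis ha : alg_degree a d.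
Hypothesis hufd : is_ufd (integers_of (Qadjoin a)).

Lemma Qdim_log_shifts_bounds : exists (P : {poly int}) (c : nat),
  [/\ irreducible_in [set: {poly int}] P, size P = d.+1 &
  forall (x : R) (N : nat), (forall n : nat, (n%:R < x) = (n < N)%N) -> (c <= N)%N ->
  let D := Qdim (Qspan (log_shifts a x)) in
  let ns := #|~: smooth_indices P x N| in
  (ns <= D)%N /\ (D <= ns + (d * prime_count N + d.*2 + 1))%N].
Proof.
have [f [fm fs fr fmin]] := alg_degreeN ha.
have fs1 : (1 < size f)%N by rewrite fs; lia.
have [P [P0 Pprim PE]] := int_min_poly fm.
have Ps := int_min_size P0 PE.
(* The norm of a scaled shift also contains powers of the leading coefficient; for [N] beyond this
   threshold their primes are at most [N]. *)
exists P, `|lead_coef P|%N; split.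
- exact: (int_min_irreducible fm fs1 fr fmin).
- by rewrite Ps.
move=> x N NE cN D ns; set g := - a in fr fmin.
have gnat (n : nat) : n%:R - g != 0.
  have f2 : (2 < size f)%N by rewrite fs; lia.
  exact: (shift_neq0 fmin n f2).
have [rs frs0] := closed_field_poly_normal (f^ratr : {poly R[i]}).
have frs : f^ratr = \prod_(r <- rs) ('X - r%:P).
  by rewrite frs0 lead_coef_map (monicP fm) rmorph1 scale1r.
have rsz : size rs = d by rewrite (size_roots_min frs) fs.
have gufd : is_ufd (inring g).
  have <- // : integers_of (Qadjoin a) = inring g.
  by apply/seteqP; split => z [] /(Qadjoin_infield z ha).
pose l (i : 'I_N) := clog (i%:R - g).
have lE : log_shifts a x = range l.
  apply/seteqP; split => [z [n [n0 nx ->]]|_ [i _ <-]].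
    case: n n0 nx => // n _; rewrite -[n%:~R]/(n%:R : R) NE => nN.
    by exists (Ordinal nN) => //; rewrite /l /g opprK.
  exists i%:Z; split => //; first by rewrite -[_%:~R]/(i%:R : R) NE.
  by rewrite /l /g opprK.
have pN p : p%:R <= x -> (p <= N)%N.
  case: p => // p px; rewrite -NE; apply: lt_le_trans px.
  by rewrite ltr_nat.
rewrite /D lE; split.
  apply: Qdim_ge_free; apply: (nonsmooth_free gnat (int_min_dvd fmin P0 Pprim PE)).
  move=> i; rewrite inE inE => /asboolP /existsNP[p /not_implyP[pp /not_implyP[pP px]]].
  exists p; split => //; rewrite leqNgt -NE; apply/negP => /ltW; exact: px.
have [J [fJ /Qdim_basis ->]] := Qbasis_subfamily l.
(* Basis indices outside the smooth set number at most [ns]; those inside form a free family of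
   smooth shifts. *)
rewrite -(cardsID (smooth_indices P x N) J) addnC leq_add//.
  by apply: subset_leq_card; apply/fintype.subsetP => i; rewrite !inE => /andP[].
rewrite -rsz.
apply: (smooth_family_bound fm fs1 fr fmin frs gufd gnat (c := lead_coef P)).
- by rewrite lead_coef_eq0.
- exact: (lead_gen_integral fm fs1 fr P0 PE).
- move=> i; rewrite finset.in_setI => /andP[_]; rewrite inE => /asboolP si.
  exists (lead_coef P ^+ (size f).-2 * P.[i%:Z]); split.
    exact: (knorm_shift fm fs1 fr fmin PE frs).
  move=> p pp; rewrite abszM Euclid_dvdM// => /orP[|/(si _ pp)/pN//].
  rewrite abszX Euclid_dvdX// => /andP[pc _]; apply: leq_trans cN.
  by apply: dvdn_leq pc; rewrite absz_gt0 lead_coef_eq0.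
apply: Qfree_onS fJ; exact: finset.subsetIl.
Qed.

End Bounds.

(** * The asymptotic formula *)

Theorem theorem4 (R : realType) (rho : R -> R) (hrho : is_dickman rho)
  (d : nat) (hd : (2 <= d)%N)
  (hPsi : forall P : {poly int},
     irreducible_in [set: {poly int}] P -> size P = d.+1 ->
     forall u : R, 0 < u ->
       asymp_equiv (fun y : R => (Psi P (y `^ u) y)%:R)
                   (fun y : R => rho (d%:R * u) * y `^ u))
  (a : R[i]) (ha : alg_degree a d)
  (hufd : is_ufd (integers_of (Qadjoin a))) :
  asymp_equiv (fun x : R => (Qdim (Qspan (log_shifts a x)))%:R)
              (fun x : R => (1 - rho d%:R) * x).
Proof.
have [P [c [Pirr Ps bounds]]] := Qdim_log_shifts_bounds hd ha hufd.
have r0 : forall u, 0 < u -> 0 <= rho u.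
  by apply: (@dickman_ge0 _ _ d P); [lia|exact: hPsi].
have rd1 : rho d%:R < 1 := dickman_lt1 hrho r0 hd.
have rd0 : 0 <= rho d%:R by apply: r0; rewrite ltr0n; lia.
have P3 : (2 < size P)%N by rewrite Ps.
have [B Binj] := int_poly_eventually_inj P3.
set r := rho d%:R in rd0 rd1 *.
(* The quarter leaves room for three errors of at most [e1 * x]: from [Psi], from the prime count,
   and from the bounded terms. *)
apply/asymp_equivP => e e0; pose k := 1 - r; pose e1 := e * k / 4.
have k0 : 0 < k by rewrite /k; lra.
have e10 : 0 < e1 by rewrite /e1 divr_gt0 ?mulr_gt0.
(* With this [L], [prime_count_le] bounds [d * prime_count N] by [e1 * N] plus a constant. *)
have [L L0 dL] : exists2 L : nat, (0 < L)%N & d%:R <= e1 * L%:R.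
  exists (Num.truncn (d%:R / e1)).+1 => //.
  have /truncn_itv/andP[_ /ltW] : 0 <= d%:R / e1 by rewrite divr_ge0// ltW.
  by rewrite ler_pdivrMr// mulrC.
(* [K] dominates all terms independent of [x] except [e1], which comes from [N <= x + 1]. *)
pose K : nat := (B + 1 + d * 4 ^ L + d.*2 + 3)%N.
(* At [u = 1] the range of [n] and the smoothness bound are both [x]. *)
have /asymp_equivP/(_ e1 e10) := hPsi P Pirr Ps 1 ltr01.
rewrite mulr1 -/r => hP.
near=> x.
have x0 : 0 < x by near: x; apply: nbhs_pinfty_gt; exact: num_real.
have xc : c%:R <= x by near: x; apply: nbhs_pinfty_ge; exact: num_real.
have xK : (K%:R + e1) / e1 <= x by near: x; apply: nbhs_pinfty_ge; exact: num_real.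
have : `|(Psi P (x `^ 1) x)%:R - r * x `^ 1| <= e1 * `|r * x `^ 1| by near: x.
rewrite powRr1; last exact: ltW.
pose N := `|Num.ceil x|%N.
have NZ : N%:Z = Num.ceil x by rewrite /N gez0_abs// ltW// ceil_gt0.
have NE (n : nat) : (n%:R < x) = (n < N)%N.
  by rewrite -ltz_nat NZ ceil_gt_int.
have xN : x <= N%:R by rewrite leNgt NE ltnn.
have Nx : N%:R <= x + 1.
  have N0 : (0 < N)%N by rewrite -NE.
  have : (N.-1%:R < x) by rewrite NE; lia.
  by rewrite -{2}(prednK N0) -natr1; lra.
have cN : (c <= N)%N by rewrite -(ler_nat R); lra.
have [lo hi] := bounds x N NE cN.
have Sle := @Psi_le_smooth R P x N NE.
have Sge := @smooth_le_Psi R P x N NE B Binj.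
have SN := cardsC (smooth_indices P x N); rewrite card_ord in SN.
have pc := prime_count_le L N.
move: lo hi; set D := Qdim _ => lo hi.
set Q := Psi P x x in Sle Sge *; set S := #|smooth_indices P x N| in Sle Sge SN.
set ns := #|_| in lo hi SN.
move: lo hi Sle Sge SN pc => /=; rewrite -!(ler_nat R) => lo hi Sle Sge.
move=> /(congr1 (fun n : nat => n%:R : R)) SN pc hPx.
rewrite (ger0_norm (mulr_ge0 rd0 (ltW x0))) in hPx.
have rx : r * x <= x by rewrite -[leRHS]mul1r ler_wpM2r// ltW.
have {hPx} hPx : `|Q%:R - r * x| <= e1 * x.
  by apply: le_trans hPx _; rewrite ler_wpM2l// ltW.
have kx : 0 <= k * x by rewrite mulr_ge0// ltW.
rewrite -/k (ger0_norm kx).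
have ek : e * (k * x) = 4 * (e1 * x) by rewrite /e1; field.
rewrite ek.
have Kx : K%:R + e1 <= e1 * x by move: xK; rewrite ler_pdivrMr// mulrC.
have dpc : d%:R * (prime_count N)%:R <= e1 * N%:R + d%:R * 4 ^+ L :> R.
  have LR : 0 < L%:R :> R by rewrite ltr0n.
  rewrite -(ler_pM2l LR).
  have h1 : L%:R * (prime_count N)%:R <= N%:R + L%:R * 4 ^+ L :> R.
    by move: pc; rewrite natrD !natrM natrX.
  have h2 := ler_wpM2l (ler0n R d) h1.
  have h3 := ler_wpM2r (ler0n R N) dL.
  lra.
have e1N : e1 * N%:R <= e1 * x + e1.
  by have := ler_wpM2l (ltW e10) Nx; rewrite mulrDr mulr1.
move: hi Sge SN; rewrite !natrD !natrM => hi Sge SN.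
have KE : K%:R = B%:R + 1 + d%:R * 4 ^+ L + d.*2%:R + 3 :> R.
  by rewrite /K !natrD natrM natrX.
have B0 : 0 <= B%:R :> R by [].
have d20 : 0 <= d.*2%:R :> R by [].
have d40 : 0 <= d%:R * 4 ^+ L :> R by rewrite mulr_ge0// exprn_ge0.
move: hPx; rewrite ler_norml => /andP[hP1 hP2].
rewrite -[B.+1]addn1 natrD in Sge.
have kE : k * x = x - r * x by rewrite /k; ring.
rewrite kE ler_norml; apply/andP; split; lra.
Unshelve. all: by end_near.
Qed.
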